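(* Let $(Z,X)$ be a pair of real random variables with a continuous joint distribution $F_{Z,X}$, let $n\in\mathbb{N}$, $m\in\{1,\dots,n\}$ and $\alpha\in(0,1]$. Then the success probability satisfies $$p_{\mathrm{success}}^{F_{Z,X}}(n,m,\alpha)=\frac{n!}{(n-m)!}\int_{0}^{1}\int_{0}^{z_m}\cdots\int_{0}^{z_2}\Bigl[1-\prod_{j=1}^{m}\bigl(1-\mathcal{C}_{X|Z}(\alpha\mid z_j)\bigr)\Bigr](1-z_m)^{n-m}\,\mathrm{d}z_1\cdots\mathrm{d}z_{m-1}\,\mathrm{d}z_m .$$
   Context: Setting. $(Z,X)$ is a pair of real random variables with continuous joint CDF $F_{Z,X}$ and marginal CDFs $F_Z,F_X$. Let $(Z_1,X_1),\dots,(Z_n,X_n)$ be i.i.d. copies of $(Z,X)$. Order the $Z$-values as $Z_{1:n}\le\dots\le Z_{n:n}$ (ties have probability zero), and let $X_{\langle i\rangle}$ be the $X$-value attached to $Z_{i:n}$, i.e. $X_{\langle i\rangle}=X_k$ when $Z_{i:n}=Z_k$. Success probability. For $1\le m\le n$ and $\alpha\in(0,1]$, $$p_{\mathrm{success}}^{F_{Z,X}}(n,m,\alpha):=\Pr\Bigl(\bigcup_{i=1}^{m}\{X_{\langle i\rangle}\le x_\alpha^*\}\Bigr)=\Pr\Bigl(\min_{1\le i\le m}X_{\langle i\rangle}\le x_\alpha^*\Bigr),$$ where $x_\alpha^*$ is such that $\Pr(X\le x_\alpha^* )=\alpha$ (with $x_1^*=+\infty$ allowed). Conditional copula. Since the distribution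 is continuous, $F_Z(Z)$ and $F_X(X)$ are $\mathrm{Uniform}(0,1)$, and $\mathcal{C}_{X|Z}(x\mid z):=\Pr(F_X(X)\le x\mid F_Z(Z)=z)$ denotes (a version of) the conditional CDF of $F_X(X)$ given $F_Z(Z)=z$. For $m=1$ the iterated integral is the single integral over $z_1\in(0,1)$. *)

(* Defs.v *)
From HB Require Import structures.
From mathcomp Require Export all_boot all_order all_algebra.
From mathcomp Require Export all_classical all_reals all_analysis.
Export Order.TTheory GRing.Theory Num.Theory.
Export numFieldNormedType.Exports.

Set Implicit Arguments.
Unset Strict Implicit.
Unset Printing Implicit Defensive.

Local Open Scope classical_set_scope.
Local Open Scope ring_scope.

Definition joint_cdf d (T : measurableType d) (R : realType)
    (P : probability T R) (Z X : {RV P >-> R}) (p : R * R) : R :=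
  fine (P [set w | Z w <= p.1 /\ X w <= p.2]).

Definition marginal_cdf d (T : measurableType d) (R : realType)
    (P : probability T R) (X : {RV P >-> R}) (x : R) : R := fine (cdf X x).

Definition mutually_independent d d' (T : measurableType d)
    (U : measurableType d') (R : realType) (P : probability T R)
    (I : finType) (W : I -> T -> U) : Prop :=
  forall (J : {set I}) (A : I -> set U), (forall i, measurable (A i)) ->
    P (\bigcap_(i in [set` J]) (W i @^-1` A i)) =
    (\prod_(i in J) P (W i @^-1` A i))%E.

Definition iid_copies d d' (T : measurableType d) (T' : measurableType d')
    (R : realType) (P : probability T R) (Z X : {RV P >-> R})
    (Q : probability T' R) (n : nat) (Zs Xs : 'I_n -> {RV Q >-> R}) : Prop :=
  mutually_independent Q (fun i w => (Zs i w, Xs i w)) /\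
  forall i (A : set (R * R)), measurable A ->
    Q [set w | A (Zs i w, Xs i w)] = P [set w | A (Z w, X w)].

(* Indices are 0-based: [order_stat Zs i] is Z_{i+1:n} and
   [concomitant Zs Xs i] is X_<i+1>.  If there are ties, [index] selects the
   first k such that Z_k = Z_{i+1:n}. *)
Definition order_stat (T : Type) (R : realType) (n : nat)
    (Zs : 'I_n -> T -> R) (i : nat) (w : T) : R :=
  (sort <=%R [seq Zs k w | k <- enum 'I_n])`_i.

Definition concomitant (T : Type) (R : realType) (n : nat)
    (Zs Xs : 'I_n -> T -> R) (i : nat) (w : T) : R :=
  [seq Xs k w | k <- enum 'I_n]`_
    (index (order_stat Zs i w) [seq Zs k w | k <- enum 'I_n]).

Definition p_success d (T : measurableType d) (R : realType)
    (Q : probability T R) (n : nat) (Zs Xs : 'I_n -> {RV Q >-> R})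
    (m : nat) (xstar : \bar R) : \bar R :=
  Q (\bigcup_(i in `I_m) [set w | ((concomitant Zs Xs i w)%:E <= xstar)%E]).

(* [g] is a version of v |-> P(A | V = v), in Kolmogorov's sense. *)
Definition cond_prob_version d (T : measurableType d) (R : realType)
    (P : probability T R) (A : set T) (V : T -> R) (g : R -> R) : Prop :=
  measurable_fun setT g /\
  forall B : set R, measurable B ->
    P (A `&` V @^-1` B) = (\int[P]_(w in V @^-1` B) (g (V w))%:E)%E.

(* [C x z] is C_{X|Z}(x | z) = P(F_X(X) <= x | F_Z(Z) = z). *)
Definition conditional_copula d (T : measurableType d) (R : realType)
    (P : probability T R) (Z X : {RV P >-> R}) (C : R -> R -> R) : Prop :=
  forall x : R,
    cond_prob_version P [set w | marginal_cdf X (X w) <= x]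
      (fun w => marginal_cdf Z (Z w)) (C x).

(* \int_0^b \int_0^{z_k} ... \int_0^{z_2} g [:: z_1; ...; z_k]
     dz_1 ... dz_{k-1} dz_k *)
Fixpoint iterated_integral (R : realType) (k : nat) (b : R)
    (g : seq R -> \bar R) : \bar R :=
  if k is k'.+1 then
    (\int[lebesgue_measure]_(z in `]0%R, b[)
       iterated_integral k' z (fun s => g (rcons s z)))%E
  else g [::].

(* Main.v *)
(* Let V = F_Z(Z), which is uniform on ]0, 1[, and split according to the index
   k of the m-th smallest Z-value and the set S of the m - 1 indices below it.
   On such a configuration the search fails iff X_i > x*_alpha for all i in
   k |: S.  By independence, a configuration, respectively a configuration on
   which the search fails, has probability
     \int H(v)^(m-1) (1 - v)^(n-m) dH(v),
   where H(v) = v, respectively H(v) = \int_0^v (1 - C(alpha | z)) dz, and there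
   are n 'C(n-1, m-1) configurations.  On the other side, H has no jumps, so
   \int_0^b H^k dH = H(b)^(k+1) / (k+1), and by induction the inner integrals of
   the formula are v^k / k! and H(v)^k / k!. *)

From HB Require Import structures.
From mathcomp Require Import measurable_realfun ring.
Require Import Defs.

Set Implicit Arguments.
Unset Strict Implicit.
Unset Printing Implicit Defensive.

Local Open Scope classical_set_scope.
Local Open Scope ring_scope.

(** The function [C alpha] is only a version: it may be negative or exceed 1 on a null set, so
    nothing is known pointwise about h = 1 - C(alpha | .). The proof therefore works with the
    measure rho(S) = P(V in S, X > x*_alpha), whose density on ]0, 1[ is h; signs and finiteness are
    read off the measure. Allowing all values of X gives a measure nu with density 1, so the two
    terms of 1 - prod (1 - C) are two instances of one computation. Splitting them requires
    integrability.

    The integrals \int H^(m-1) (1 - v)^(n-m) dH are never evaluated: they are finite, being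
    probabilities, and occur on both sides as constants [c] and [e]. A further gap to close is that
    [C] describes the event F_X(X) <= alpha, whereas success is about X <= x*_alpha. *)

(** * Integration against a measure with a density *)

Section density.
Local Open Scope ereal_scope.
Context d (T : measurableType d) (R : realType).
Variables (mu rho : {measure set T -> \bar R}) (phi : T -> \bar R).
Hypotheses (mphi : measurable_fun setT phi) (phi0 : forall x, 0 <= phi x).
Hypothesis phi_fin : forall x, phi x \is a fin_num.
Hypothesis rhoE : forall A, measurable A -> rho A = \int[mu]_(x in A) phi x.

Import HBNNSimple.

Let integral_density_nnsfun (g : {nnsfun T >-> R}) :
  \int[rho]_x (g x)%:E = \int[mu]_x ((g x)%:E * phi x).
Proof.
rewrite integralT_nnsfun sintegralE.
transitivity (\sum_(r \in range g)
    \int[mu]_x (r%:E * ((\1_(g @^-1` [set r]) x)%:E * phi x))).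
  apply: eq_fsbigr => r; rewrite inE => -[t _ gt].
  have r0 : (0 <= r)%R by rewrite -gt.
  rewrite ge0_integralZl//; first last.
  - by move=> x _; apply: mule_ge0 => //; rewrite lee_fin.
  - by apply: emeasurable_funM => //; exact/measurable_EFinP.
  rewrite rhoE// [in LHS]integral_mkcond; congr (_ * _).
  apply: eq_integral => x _; rewrite patchE indicE.
  by case: ifPn => _; rewrite (mul1e, mul0e).
rewrite -ge0_integral_fsum//; first last.
- move=> r x _; rewrite muleA; apply: mule_ge0 => //.
  by rewrite -EFinM lee_fin; exact: nnfun_muleindic_ge0.
- move=> r; apply: emeasurable_funM => //; apply: emeasurable_funM => //.
  exact/measurable_EFinP.
apply: eq_integral => x _.
under eq_fsbigr do rewrite muleA -EFinM.
rewrite -ge0_mule_fsuml; last first.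
  by move=> r; rewrite EFinM nnfun_muleindic_ge0.
by rewrite fsumEFin// -fimfunE.
Qed.

(** Linearity extends [rhoE] from indicators to simple functions, and monotone convergence on both
    sides does the rest. Finiteness of [phi] makes multiplication by [phi x] continuous, so the
    approximations converge to [f x * phi x]. *)
Lemma ge0_integral_density (f : T -> \bar R) :
  measurable_fun setT f -> (forall x, 0 <= f x) ->
  \int[rho]_x f x = \int[mu]_x (f x * phi x).
Proof.
move=> mf f0; pose f_ := nnsfun_approx measurableT mf.
have cf x : EFin \o f_^~ x @ \oo --> f x.
  by apply: cvg_nnsfun_approx.
transitivity (limn (fun n => \int[rho]_x (f_ n x)%:E)).
  rewrite -monotone_convergence//.
  - by apply: eq_integral => y _; apply/esym/cvg_lim => //; exact: cf.
  - by move=> n; exact/measurable_EFinP.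
  - by move=> n y _; rewrite lee_fin.
  - by move=> y _ m n mn; rewrite lee_fin; exact/lefP/nd_nnsfun_approx.
under eq_fun do rewrite integral_density_nnsfun.
rewrite -monotone_convergence//.
- apply: eq_integral => y _; apply/cvg_lim => //.
  by apply: cvgeZr => //; exact: cf.
- by move=> n; apply: emeasurable_funM => //; exact/measurable_EFinP.
- by move=> n y _; apply: mule_ge0 => //; rewrite lee_fin.
- move=> y _ m n mn; apply: lee_wpmul2r => //.
  by rewrite lee_fin; exact/lefP/nd_nnsfun_approx.
Qed.

End density.

(** * The law of a random variable on an event *)

Section restricted_law.
Local Open Scope ereal_scope.
Context d d' (T : measurableType d) (U : measurableType d') (R : realType).
Variables (Q : probability T R) (V : T -> U) (G : set T).
Hypotheses (mV : measurable_fun setT V) (mG : measurable G).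

(** An unnormalised conditional law. The measurability proofs are arguments so that the measure
    structure can be inferred from the term itself. *)
Definition restricted_law (_ : measurable_fun setT V) (_ : measurable G)
  (S : set U) : \bar R := Q (V @^-1` S `&` G).

Local Notation rho := (restricted_law mV mG).

Let rho0 : rho set0 = 0.
Proof. by rewrite /restricted_law preimage_set0 set0I measure0. Qed.

Let rho_ge0 S : 0 <= rho S.
Proof. exact: measure_ge0. Qed.

Let rho_sigma_additive : semi_sigma_additive rho.
Proof.
have -> : rho = pushforward (mrestr Q mG) V by [].
exact: measure_semi_sigma_additive.
Qed.

HB.instance Definition _ := isMeasure.Build _ _ _ rho
  rho0 rho_ge0 rho_sigma_additive.

Let rho_fin : fin_num_fun rho.
Proof.
move=> S mS; rewrite /restricted_law fin_num_measure//.
by apply: measurableI => //; rewrite -[X in measurable X]setTI; exact: mV.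
Qed.

HB.instance Definition _ := @Measure_isFinite.Build _ U R rho rho_fin.

End restricted_law.

(** * Independence: integration over a pivot *)

Section pivot.
Local Open Scope ereal_scope.
Context d d' (T : measurableType d) (U : measurableType d') (R : realType).
Variables (Q : probability T R) (I : finType) (W : I -> T -> U).
Hypothesis mW : forall i, measurable_fun setT (W i).
Variable mu : {finite_measure set U -> \bar R}.
Hypothesis indep : mutually_independent Q W.
Hypothesis lawW : forall i A, measurable A -> Q (W i @^-1` A) = mu A.
Variable k : I.

Let ev (D : I -> set (U * U)) : set T :=
  \bigcap_(i in [set i | i != k]) [set w | D i (W k w, W i w)].

Let mpair i : measurable_fun setT (fun w => (W k w, W i w)).
Proof. exact: measurable_fun_pair. Qed.

Let mev D : (forall i, measurable (D i)) -> measurable (ev D).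
Proof.
move=> mD; apply: fin_bigcap_measurable => [|i _]; first exact: finite_finset.
by rewrite -[X in measurable X]setTI; exact: mpair.
Qed.

Let msec (D : I -> set (U * U)) (r : pred I) : (forall i, measurable (D i)) ->
  measurable_fun setT (fun x => \prod_(i | r i) mu (xsection (D i) x)).
Proof.
move=> mD; rewrite (_ : (fun _ => _) = (fun x => \prod_(i <- index_enum I)
    if r i then mu (xsection (D i) x) else 1)); last first.
  by apply/funext => x; rewrite -big_mkcond.
elim: index_enum => [|i s IH].
  by under eq_fun do rewrite big_nil; exact: measurable_cst.
under eq_fun do rewrite big_cons; apply: emeasurable_funM => //.
by case: (r i) => //; exact: (measurable_fun_xsection mu (mD i)).
Qed.

(* Fubini is used once per index: the sections are freed one after the other,
   the remaining constraints being product sets. *)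
Let pivot_seq (s : seq I) (D : I -> set (U * U)) :
  (forall i, measurable (D i)) ->
  (forall i, i != k -> i \notin s ->
     exists2 A, measurable A & D i = setT `*` A) ->
  forall E, measurable E ->
  Q (W k @^-1` E `&` ev D) =
  \int[mu]_(x in E) \prod_(i | i != k) mu (xsection (D i) x).
Proof.
elim: s D => [|i0 s IH] D mD Ds E mE.
  have /choice[A HA] : forall i, exists A, measurable A /\
      (i != k -> D i = setT `*` A).
    move=> i; have [->|/Ds] := eqVneq i k; first by exists setT.
    by case=> // A mA DA; exists A.
  (* Each constraint now bears on a single variable, [E] being the one on the pivot, so independence
     applies directly. *)
  pose A' i := if i == k then E else A i.
  have mA' i : measurable (A' i).
    by rewrite /A'; case: ifP => // _; case: (HA i).
  have -> : W k @^-1` E `&` ev D =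
      \bigcap_(i in [set` [set: I]%SET]) (W i @^-1` A' i).
    apply/seteqP; split=> [w [Ew Dw] i _ |w Aw].
      rewrite /A' /=; case: eqVneq => [->//|ik].
      by have := Dw i ik; rewrite /= (HA i).2// => -[].
    have {}Aw i : A' i (W i w) by apply: (Aw i); rewrite /= finset.in_setT.
    split=> [|i ik] /=.
      by have := Aw k; rewrite /A' /= eqxx.
    rewrite (HA i).2//; split => //=.
    by have := Aw i; rewrite /A' /= (negbTE ik).
  rewrite indep//.
  have secA x i : i != k -> mu (xsection (D i) x) = mu (A i).
    move=> ik; rewrite (HA i).2//; congr (mu _).
    by apply/seteqP; split=> y; rewrite /xsection /= inE => // -[].
  under eq_integral => x _ do under eq_bigr => i ik do rewrite secA//.
  rewrite integral_cst//=.
  under eq_bigl do rewrite finset.in_setT.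
  rewrite (bigD1 k)//= muleC lawW// {2}/A' eqxx; congr (_ * _).
  by apply: eq_bigr => i ik; rewrite lawW// /A' (negbTE ik).
have [i0k|i0k] := eqVneq i0 k.
  apply: IH => // i ik is_; apply: Ds => //.
  by rewrite inE negb_or is_ i0k ik.
(* The constraint at [i0] is replaced by membership in an arbitrary [B]; varying [B] recovers the
   joint law of the pivot and [W i0] on the other constraints. *)
pose D' B i := if i == i0 then setT `*` B else D i.
have mD' B i : measurable B -> measurable (D' B i).
  by move=> mB; rewrite /D'; case: ifP => // _; exact: measurableX.
have IH' B F : measurable B -> measurable F ->
    Q (W k @^-1` F `&` ev (D' B)) =
    \int[mu]_(x in F) (mu B * \prod_(i | (i != k) && (i != i0))
                        mu (xsection (D i) x)).
  move=> mB mF; rewrite IH//; last first.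
  - move=> i ik is_; rewrite /D'; case: eqVneq => [ii0|ii0]; first by exists B.
    by apply: Ds => //; rewrite inE negb_or ii0.
  - by move=> i; exact: mD'.
  apply: eq_integral => x _; rewrite (bigD1 i0)//=; congr (_ * _).
    by rewrite /D' eqxx; congr (mu _); apply/seteqP; split=> y;
      rewrite /xsection /= inE// => -[].
  by apply: eq_bigr => i /andP[_ ii0]; rewrite /D' (negbTE ii0).
have mG : measurable (ev (D' setT)) by apply: mev => i; exact: mD'.
have EW B : ev (D' B) = W i0 @^-1` B `&` ev (D' setT).
  apply/seteqP; split => [w Dw|w [Bw Dw] i ik /=].
    split; first by have := Dw i0 i0k; rewrite /D' /= eqxx => -[].
    by move=> i ik; have := Dw i ik; rewrite /D' /=; case: ifP => // _ [].
  by have := Dw i ik; rewrite /D' /=; case: eqVneq => // ->.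
pose rk := restricted_law Q (mW k) mG.
pose rki := restricted_law Q (mpair i0) mG.
have rkE F : measurable F -> rk F = \int[mu]_(x in F)
    \prod_(i | (i != k) && (i != i0)) mu (xsection (D i) x).
  move=> mF; rewrite /rk /restricted_law IH'//.
  rewrite -[mu setT](lawW k)// preimage_setT probability_setT.
  by under eq_integral do rewrite mul1e.
(* The induction hypothesis gives agreement on rectangles, which determines the product measure; the
   true constraint [D i0] can then be imposed on the pair. *)
have prodE S : measurable S -> (rk \x mu) S = rki S.
  apply: product_measure_unique => F B mF mB.
  transitivity (Q (W k @^-1` F `&` ev (D' B))); first by rewrite (EW B) setIA.
  rewrite IH'// ge0_integralZl//.
  - by rewrite muleC; congr (_ * _); exact/esym/rkE.
  - by apply: measurable_funTS; exact: msec.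
  - by move=> x _; exact: prode_ge0.
have -> : W k @^-1` E `&` ev D = (fun w => (W k w, W i0 w)) @^-1`
    ((E `*` setT) `&` D i0) `&` ev (D' setT).
  apply/seteqP; split=> [w [Ew Dw]|w [[[Ew _] D0w] Dw]].
    split; first by split => //; exact: (Dw i0).
    by move=> i ik /=; rewrite /D'; case: ifP => // _; exact: Dw.
  split=> // i ik /=; case: (eqVneq i i0) => [->//|ii0].
  by have := Dw i ik; rewrite /= /D' (negbTE ii0).
have mS : measurable ((E `*` setT) `&` D i0).
  by apply: measurableI => //; exact: measurableX.
rewrite -[LHS]/(rki _) -prodE// /product_measure1.
rewrite (ge0_integral_density _ _ _ rkE); first last.
- by move=> x /=.
- exact: (measurable_fun_xsection mu mS).
- by move=> x; apply: prode_fin_num => i _; apply: fin_num_measure;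
  exact: measurable_xsection.
- by move=> x; exact: prode_ge0.
- exact: msec.
rewrite [RHS]integral_mkcond; apply: eq_integral => x _ /=.
rewrite patchE; case: ifPn => [|nEx].
  rewrite inE => Ex; rewrite [RHS](bigD1 i0)//=; congr (mu _ * _).
  by apply/seteqP; split=> y; rewrite /xsection /= !inE//= => -[].
rewrite (_ : xsection _ x = set0) ?measure0 ?mul0e//.
apply/seteqP; split=> y //; rewrite /xsection /= inE => -[[Ex _] _].
by move: nEx; rewrite notin_setE.
Qed.

(** Given the value of the pivot, the other variables are independent with law [mu], so each
    contributes the measure of its section. Starting from the list of all indices, no constraint has
    to be a product set. *)
Lemma pivot_integral (D : I -> set (U * U)) (E : set U) :
  (forall i, measurable (D i)) -> measurable E ->
  Q (W k @^-1` E `&`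
     \bigcap_(i in [set i | i != k]) [set w | D i (W k w, W i w)]) =
  \int[mu]_(x in E) \prod_(i | i != k) mu (xsection (D i) x).
Proof.
move=> mD mE; apply: (@pivot_seq (enum I)) => // i _.
by rewrite mem_enum.
Qed.

End pivot.

(** * Integrals of powers of a distribution function *)

Section distribution_function.
Local Open Scope ereal_scope.
Context (R : realType).
Variable rho : {finite_measure set (measurableTypeR R) -> \bar R}.

(** The open ray fits the strict comparisons between sample values and the domains of the integrals
    below. *)
Definition lt_cdf (x : R) : R := fine (rho `]-oo, x[%classic).

Local Notation F := lt_cdf.

Lemma lt_cdfE x : (F x)%:E = rho `]-oo, x[%classic.
Proof. by rewrite fineK// fin_num_measure. Qed.

Lemma lt_cdf_ge0 x : (0 <= F x)%R.
Proof. exact: fine_ge0. Qed.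

Lemma lt_cdf_nd : nondecreasing_fun F.
Proof.
move=> x y xy; rewrite -lee_fin !lt_cdfE le_measure ?inE//.
by move=> z /=; rewrite !in_itv/= => /lt_le_trans; apply.
Qed.

Lemma measurable_lt_cdf : measurable_fun setT F.
Proof. by apply: nondecreasing_measurable => //; exact: lt_cdf_nd. Qed.

Lemma measurable_lt_cdfX k :
  measurable_fun setT (fun x => (F x ^+ k)%:E).
Proof.
by apply/measurable_EFinP; apply: measurable_funX; exact: measurable_lt_cdf.
Qed.

Hypothesis atomless : forall x, rho [set x] = 0.

Lemma lt_cdf_itv x y : (x < y)%R -> rho `]x, y[%classic = (F y - F x)%:E.
Proof.
move=> xy; rewrite EFinB !lt_cdfE; apply/eqP.
rewrite eq_sym sube_eq ?fin_num_adde_defl ?fin_num_measure//; apply/eqP.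
have -> : `]-oo, y[%classic = `]x, y[ `|` ([set x] `|` `]-oo, x[).
  apply/seteqP; split => z /=; rewrite !in_itv/=.
    by move=> zy; case: (ltgtP z x) => [zx|xz|->];
      [right; right|left; rewrite zy|right; left].
  by case=> [/andP[]//|[->//|/lt_trans]]; apply.
rewrite measureU//=; first last.
- apply/seteqP; split => z //=; rewrite !in_itv/= => -[/andP[xz _]].
  by case=> [zx|zx]; move: xz; rewrite ?zx ?ltxx// => /(lt_trans zx); rewrite ltxx.
- exact: measurableU.
rewrite measureU//=; last first.
  by apply/seteqP; split => z //=; rewrite in_itv/= => -[->]; rewrite ltxx.
by rewrite [X in _ + X](_ : _ = rho `]-oo, x[%classic)// [X in X + _]atomless add0e.
Qed.

Let I k b := \int[rho]_(x in `]-oo, b[) (F x ^+ k)%:E.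

(* Both sides are the integral of F(u)^k over the triangle u < v < b. *)
Let fubini_pow k b :
  \int[rho]_(u in `]-oo, b[) (F u ^+ k * (F b - F u))%:E =
  \int[rho]_(v in `]-oo, b[) I k v.
Proof.
pose g (p : measurableTypeR R * measurableTypeR R) :=
  (((p.1 : R) < p.2)%R%:R * ((p.2 : R) < b)%R%:R * F p.1 ^+ k)%R%:E.
have mg : measurable_fun setT g.
  apply/measurable_EFinP; apply: measurable_funM; first apply: measurable_funM.
  - apply: (measurableT_comp (f := fun c : bool => c%:R%R : R)) => //.
    exact: measurable_fun_ltr.
  - apply: (measurableT_comp (f := fun c : bool => c%:R%R : R)) => //.
    exact: measurable_fun_ltr.
  - apply: measurable_funX; apply: measurableT_comp => //.
    exact: measurable_lt_cdf.
have g0 p : 0 <= g p.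
  by rewrite lee_fin !mulr_ge0// exprn_ge0// lt_cdf_ge0.
have /= := @fubini_tonelli _ _ _ _ _ rho rho g mg g0.
under eq_integral => u _.
  under eq_integral => v _.
    rewrite /g /= (_ : (_ * _ * _)%R%:E =
        (F u ^+ k)%:E * (\1_(`]u, b[) v)%:E); last first.
      rewrite -EFinM mulrC indicE; congr (_ * _)%R%:E.
      by rewrite mem_setE in_itv/= -natrM mulnb.
    over.
  rewrite ge0_integralZl//; first last.
  - by rewrite lee_fin exprn_ge0// lt_cdf_ge0.
  - by apply/measurable_EFinP; exact: measurable_indic.
  rewrite integral_indic// setIT.
  over.
under [in RHS]eq_integral => v _.
  rewrite /g /= (_ : \int[rho]_x _ = ((v < b)%R%:R)%:E * I k v); last first.
    rewrite /I [in RHS]integral_mkcond -ge0_integralZl//; first last.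
    - move=> u _; rewrite patchE; case: ifP => // _.
      by rewrite lee_fin exprn_ge0// lt_cdf_ge0.
    - apply/(measurable_restrictT _ _).1 => //.
      by apply: measurable_funTS; exact: measurable_lt_cdfX.
    apply: eq_integral => u _; rewrite patchE mem_setE in_itv/=.
    by case: (u < v)%R; rewrite ?mul1r ?mul0r ?mule0 ?EFinM.
  over.
move=> E; transitivity (\int[rho]_x ((F x ^+ k)%:E * rho `]x, b[%classic)).
  rewrite [LHS]integral_mkcond; apply: eq_integral => u _.
  rewrite patchE mem_setE in_itv/=; case: ltP => [ub|bu].
    by rewrite lt_cdf_itv// EFinM.
  by rewrite set_itv_ge ?measure0 ?mule0// bnd_simp -leNgt.
rewrite E [RHS]integral_mkcond; apply: eq_integral => v _.
by rewrite patchE mem_setE in_itv/=; case: (v < b)%R; rewrite (mul1e, mul0e).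
Qed.

(* For F(b)^(k+1), split the square ]-oo, b[^2 along its null diagonal. *)
Lemma integral_lt_cdfX k b :
  \int[rho]_(x in `]-oo, b[) (F x ^+ k)%:E = (F b ^+ k.+1 / k.+1%:R)%:E.
Proof.
elim: k b => [|k IH] b.
  under eq_integral do rewrite expr0.
  by rewrite integral_cst// mul1e expr1 divr1 lt_cdfE.
have I0 j c : 0 <= I j c.
  by apply: integral_ge0 => x _; rewrite lee_fin exprn_ge0// lt_cdf_ge0.
have mX j : measurable_fun `]-oo, b[ (fun x => (F x ^+ j)%:E).
  by apply: measurable_funTS; exact: measurable_lt_cdfX.
(* The induction hypothesis at every [v] turns the right side of [fubini_pow] into a multiple of the
   unknown integral. *)
have EI : \int[rho]_(v in `]-oo, b[) I k v = (k.+1%:R^-1)%:E * I k.+1 b.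
  rewrite [in RHS]/I -ge0_integralZl//; first last.
  - by move=> x _; rewrite lee_fin exprn_ge0// lt_cdf_ge0.
  - exact: mX.
  by apply: eq_integral => x _; rewrite /I IH mulrC EFinM.
have : (F b)%:E * I k b =
    \int[rho]_(u in `]-oo, b[) (F u ^+ k * (F b - F u))%:E + I k.+1 b.
  rewrite /I -ge0_integralD//; first last.
  - exact: mX.
  - by move=> x _; rewrite lee_fin exprn_ge0// lt_cdf_ge0.
  - apply/measurable_EFinP; apply: measurable_funM.
      by have /measurable_EFinP := mX k.
    apply: measurable_funB => //; apply: measurable_funTS.
    exact: measurable_lt_cdf.
  - move=> x; rewrite /= in_itv/= => xb.
    rewrite lee_fin mulr_ge0 ?exprn_ge0 ?lt_cdf_ge0// subr_ge0.
    by apply: lt_cdf_nd; exact: ltW.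
  rewrite -ge0_integralZl//; first last.
  - by rewrite lee_fin lt_cdf_ge0.
  - by move=> x _; rewrite lee_fin exprn_ge0// lt_cdf_ge0.
  - exact: mX.
  apply: eq_integral => x _; rewrite -EFinM -EFinD; congr EFin.
  by rewrite exprSr mulrBr subrK mulrC.
rewrite fubini_pow EI {1}/I IH -EFinM -/(I _ _).
(* The unknown x satisfies F(b)^(k+2) / (k+1) = x / (k+1) + x. The left side is finite, so x = +oo
   is excluded and the equation can be solved. *)
move: (I0 k.+1 b); case: (I k.+1 b) => [r||] //= _; last first.
  by rewrite gt0_muley ?addey// lte_fin invr_gt0 ltr0n.
rewrite -EFinM -EFinD => -[E]; congr EFin.
have k2 : (k.+1%:R + 1 != 0 :> R)%R by rewrite natr1 pnatr_eq0.
have k1 : (k.+1%:R != 0 :> R)%R by rewrite pnatr_eq0.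
rewrite [in RHS]exprS -[k.+2%:R%R]natr1.
move: (k.+1%:R)%R (F b ^+ k.+1)%R k1 k2 E => c p c0 c1 E.
apply: (mulfI (x := (c + 1) / c)).
  by rewrite mulf_neq0 ?invr_eq0.
transitivity (F b * (p / c))%R; first by rewrite E; field.
by field; rewrite c0 c1.
Qed.

End distribution_function.

(** * Densities on the unit interval and the iterated integral *)

(** Over the set where [f] is negative the integral is also nonpositive, hence zero, which forces
    [f] to vanish almost everywhere there. This yields the sign of densities known only up to null
    sets. *)
Lemma negligible_neg d (T : measurableType d) (R : realType)
    (mu : {measure set T -> \bar R}) (D : set T) (f : T -> R) :
  measurable D -> measurable_fun setT f ->
  (0 <= \int[mu]_(x in D `&` [set x | (f x < 0)%R]) (f x)%:E)%E ->
  mu.-negligible (D `&` [set x | (f x < 0)%R]).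
Proof.
move=> mD mf; set N := D `&` _ => If0.
have mN : measurable N.
  apply: measurableI => //.
  rewrite (_ : [set x | _] = setT `&` f @^-1` `]-oo, 0%R[%classic).
    by apply: mf => //; exact: measurable_itv.
  by rewrite setTI; apply/seteqP; split=> x /=; rewrite in_itv.
have mfN : measurable_fun N (EFin \o f).
  by apply/measurable_EFinP; exact: measurable_funTS.
have fN0 x : N x -> (0 <= - (f x)%:E)%E.
  by case=> _ /= /ltW fx; rewrite lee_fin oppr_ge0.
have IN0 : (\int[mu]_(x in N) - (f x)%:E = 0)%E.
  apply/eqP; rewrite eq_le; apply/andP; split; last exact: integral_ge0.
  rewrite -oppe_ge0 -integral_ge0N//.
  by under eq_integral do rewrite oppeK.
have /(ae_eq_integral_abs mu mN mfN) : (\int[mu]_(x in N) `|(f x)%:E| = 0)%E.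
  rewrite -[RHS]IN0; apply: eq_integral => x; rewrite inE => Nx.
  by rewrite -abseN gee0_abs// fN0.
apply: negligibleS => x Nx /= /(_ Nx)[fx0].
by case: Nx => _ /=; rewrite fx0 ltxx.
Qed.

Section iterated_density.
Local Open Scope ereal_scope.
Context (R : realType).
Local Notation leb := (@lebesgue_measure R).
Local Notation J := (`]0%R, 1%R[%classic : set R).

Section density_on_unit.
Variables (rho : {finite_measure set (measurableTypeR R) -> \bar R}).
Variable h : R -> R.
Hypothesis mh : measurable_fun setT h.
Hypothesis rhoE : forall A : set R, measurable A ->
  rho A = \int[leb]_(x in A `&` J) (h x)%:E.

Local Notation F := (lt_cdf rho).

(** A density of [rho] on the whole line that is nonnegative everywhere, as [ge0_integral_density]
    requires; [h] agrees with it almost everywhere on [J]. *)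
Let hp (x : R) : R := (Num.max (h x) 0 * \1_J x)%R.

Let mhp : measurable_fun setT hp.
Proof.
by apply: measurable_funM => //; apply: measurable_maxr.
Qed.

Let hp0 x : (0 <= hp x)%R.
Proof. by rewrite mulr_ge0// le_max lexx orbT. Qed.

(** The integral of [h] over this set is a value of the measure [rho], hence nonnegative. *)
Lemma density_on_unit_ge0 : leb.-negligible (J `&` [set x | (h x < 0)%R]).
Proof.
apply: negligible_neg => //; set N := J `&` _.
have mN : measurable N.
  apply: measurableI => //.
  rewrite (_ : [set x | _] = setT `&` h @^-1` `]-oo, 0%R[%classic).
    by apply: mh => //; exact: measurable_itv.
  by rewrite setTI; apply/seteqP; split=> x /=; rewrite in_itv.
have := rhoE mN; rewrite (_ : N `&` J = N) => [<-//|].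
by rewrite /N setIAC setIid.
Qed.

Let rhoEp A : measurable A -> rho A = \int[leb]_(x in A) (hp x)%:E.
Proof.
move=> mA; rewrite rhoE//.
transitivity (\int[leb]_(x in A `&` J) (hp x)%:E).
  apply: ae_eq_integral.
  - exact: measurableI.
  - by apply/measurable_EFinP; exact: measurable_funTS.
  - by apply/measurable_EFinP; exact: measurable_funTS.
  apply: negligibleS density_on_unit_ge0 => x /= /not_implyP[[_ Jx] hx].
  split=> //=; rewrite ltNge; apply/negP => h0; apply: hx.
  by rewrite /hp indicE mem_set// mulr1 max_l.
rewrite integral_mkcondr; apply: eq_integral => x _.
by rewrite patchE /hp indicE; case: (x \in J) => //; rewrite mulr0.
Qed.

Lemma density_on_unit_atomless x : rho [set x] = 0.
Proof. by rewrite rhoEp// integral_set1. Qed.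

(** For [b <= 1] the interval lies in [J], where [h] and [hp] agree almost everywhere. As [h] may be
    negative on a null set, integrability is derived from finiteness of the [rho]-integral; it
    serves later to integrate differences. *)
Lemma integral_density_on_unit (g : R -> R) (b : R) : (b <= 1)%R ->
  measurable_fun setT g -> (forall x, 0 <= g x)%R ->
  \int[rho]_(x in `]-oo, b[) (g x)%:E < +oo ->
  leb.-integrable `]0%R, b[ (fun z => (h z * g z)%:E) /\
  \int[leb]_(z in `]0%R, b[) (h z * g z)%:E =
    \int[rho]_(x in `]-oo, b[) (g x)%:E.
Proof.
move=> b1 mg g0 goo.
have JE (z : R) : `]0%R, b[%classic z -> J z.
  by rewrite /= !in_itv/= => /andP[-> /lt_le_trans]; apply.
have hF0 z : (0 <= hp z * g z)%R.
  by rewrite mulr_ge0 ?hp0.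
have ae : ae_eq leb `]0%R, b[%classic
    (fun z => (h z * g z)%:E) (fun z => (hp z * g z)%:E).
  apply: negligibleS density_on_unit_ge0 => z /= /not_implyP[/JE Jz hz].
  split=> //=; rewrite ltNge; apply/negP => h0; apply: hz.
  by rewrite /hp indicE mem_set// mulr1 max_l.
have m1 : measurable_fun `]0%R, b[%classic (fun z => (h z * g z)%:E).
  by apply/measurable_EFinP; apply: measurable_funTS; exact: measurable_funM.
have m2 : measurable_fun `]0%R, b[%classic (fun z => (hp z * g z)%:E).
  by apply/measurable_EFinP; apply: measurable_funTS; exact: measurable_funM.
have E : \int[leb]_(z in `]0%R, b[) (hp z * g z)%:E =
    \int[rho]_(x in `]-oo, b[) (g x)%:E.
  rewrite [RHS]integral_mkcond (ge0_integral_density _ _ _ rhoEp)//; first last.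
  - move=> z; rewrite patchE; case: ifP => // _.
    by rewrite lee_fin.
  - apply/(measurable_restrictT _ _).1 => //.
    by apply: measurable_funTS; exact/measurable_EFinP.
  - exact/measurable_EFinP.
  rewrite [LHS]integral_mkcond; apply: eq_integral => z _.
  rewrite !patchE !mem_setE !in_itv/= /hp indicE mem_setE in_itv/=.
  case: (ltP z b) => zb; last by rewrite andbF mul0e.
  rewrite (lt_le_trans zb b1) !andbT.
  case: (0 < z)%R; first by rewrite mulrC EFinM.
  by rewrite mulr0 mule0.
split; last by rewrite -E; exact: ae_eq_integral.
apply/integrableP; split => //.
have -> : \int[leb]_(z in `]0%R, b[) `|(h z * g z)%:E| =
    \int[leb]_(z in `]0%R, b[) (hp z * g z)%:E.
  apply: ae_eq_integral => //; first exact: measurableT_comp.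
  apply: negligibleS ae => z /= /not_implyP[zb hz]; apply/not_implyP.
  by split=> // -[E']; apply: hz; rewrite E' ger0_norm.
by rewrite E.
Qed.

Lemma integral_on_unit (g : R -> R) :
  measurable_fun setT g -> (forall x, 0 <= g x)%R ->
  \int[rho]_x (g x)%:E = \int[rho]_(x in `]-oo, 1%R[) (g x)%:E.
Proof.
move=> mg g0; have mEg : measurable_fun setT (EFin \o g).
  exact/measurable_EFinP.
have mEhp : measurable_fun setT (EFin \o hp) by exact/measurable_EFinP.
have density f : measurable_fun setT f -> (forall x, 0 <= f x) ->
    \int[rho]_x f x = \int[leb]_x (f x * (hp x)%:E).
  move=> mf f0; rewrite (ge0_integral_density _ _ _ rhoEp)//.
rewrite [RHS]integral_mkcond !density//.
- apply: eq_integral => x _; rewrite patchE mem_setE in_itv/=.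
  case: ifPn => // /negbTE x1.
  by rewrite /= /hp indicE mem_setE in_itv/= x1 andbF mulr0 !mule0.
- apply/(measurable_restrictT _ _).1 => //; exact: measurable_funTS.
- by move=> x; rewrite patchE; case: ifP => // _; rewrite /= lee_fin.
Qed.

Lemma integral_density_lt_cdfX k (b : R) : (b <= 1)%R ->
  leb.-integrable `]0%R, b[ (fun z => (h z * F z ^+ k)%:E) /\
  \int[leb]_(z in `]0%R, b[) (h z * F z ^+ k)%:E =
    (F b ^+ k.+1 / k.+1%:R)%:E.
Proof.
move=> b1; rewrite -integral_lt_cdfX; last exact: density_on_unit_atomless.
apply: (@integral_density_on_unit (fun z => F z ^+ k)%R) => //.
- by apply: measurable_funX; exact: measurable_lt_cdf.
- by move=> x; rewrite exprn_ge0// lt_cdf_ge0.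
- by rewrite integral_lt_cdfX ?ltry//; exact: density_on_unit_atomless.
Qed.

End density_on_unit.

(** Only sequences of length [k] reach the integrand, so the entries of [rcons s z] can be computed
    under the integral without meeting the default of [nth]. *)
Lemma iterated_integral_ext k (b : R) (f g : seq R -> \bar R) :
  (forall s, size s = k -> f s = g s) ->
  iterated_integral k b f = iterated_integral k b g.
Proof.
elim: k b f g => [|k IH] b f g fg /=; first exact: fg.
apply: eq_integral => z _; apply: IH => s sk.
by apply: fg; rewrite size_rcons sk.
Qed.

Variables (nu rho : {finite_measure set (measurableTypeR R) -> \bar R}).
Hypothesis nuE : forall A : set R, measurable A -> nu A = leb (A `&` J).
Variable h : R -> R.
Hypothesis mh : measurable_fun setT h.
Hypothesis rhoE : forall A : set R, measurable A ->
  rho A = \int[leb]_(x in A `&` J) (h x)%:E.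

Let nuE1 (A : set R) : measurable A -> nu A = \int[leb]_(x in A `&` J) (1%R : R)%:E.
Proof.
move=> mA; rewrite nuE// integral_cst ?mul1e//; exact: measurableI.
Qed.

Lemma lt_cdf_unit b : (0 <= b <= 1)%R -> lt_cdf nu b = b.
Proof.
move=> /andP[b0 b1]; rewrite /lt_cdf nuE//.
rewrite (_ : _ `&` _ = `]0%R, b[%classic).
  rewrite lebesgue_measure_itv/= lte_fin; case: ifPn => [_|].
    by rewrite -EFinB subr0.
  by rewrite -leNgt => b0'; apply/eqP; rewrite eq_le b0.
apply/seteqP; split => x /=; rewrite !in_itv/=.
  by move=> [-> /andP[->]].
by move=> /andP[-> xb]; rewrite xb (lt_le_trans xb).
Qed.

(** The coefficients [a] and [e] make the induction close: fixing the outermost variable z keeps the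
    shape, with [e] replaced by [e * h z]. *)
Lemma iterated_integral_prod k (b a e : R) : (0 <= b <= 1)%R ->
  iterated_integral k b (fun s => (a - e * \prod_(j < k) h s`_j)%:E) =
  (a * (b ^+ k / k`!%:R) - e * (lt_cdf rho b ^+ k / k`!%:R))%:E.
Proof.
elim: k b a e => [|k IH] b a e b01 /=.
  by rewrite big_ord0 !expr0 !divr1 !mulr1.
have /andP[b0 b1] := b01.
have m1 : measurable_fun setT (fun _ : R => 1%R : R) by [].
have [i1] := integral_density_lt_cdfX m1 nuE1 k b1.
have [i2 I2 I1] := integral_density_lt_cdfX mh rhoE k b1.
(* On the unit interval z is [lt_cdf nu z], so the power of z is the instance with density 1 of the
   same integral formula. *)
transitivity (\int[leb]_(z in `]0%R, b[)
    ((a / k`!%:R)%:E * (1 * lt_cdf nu z ^+ k)%:E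
     - (e / k`!%:R)%:E * (h z * lt_cdf rho z ^+ k)%:E)).
  apply: eq_integral => z; rewrite mem_setE in_itv/= => /andP[z0 zb].
  have z01 : (0 <= z <= 1)%R by rewrite (ltW z0) (ltW (lt_le_trans zb b1)).
  rewrite (@iterated_integral_ext _ _ _
    (fun s => (a - (e * h z) * \prod_(j < k) h s`_j)%:E)); last first.
    move=> s sk; rewrite big_ord_recr/= nth_rcons sk ltnn eqxx.
    rewrite [X in (e * (X * _))%R](eq_bigr (fun j : 'I_k => h s`_j)).
      by rewrite mulrA mulrAC.
    by move=> j _; rewrite nth_rcons sk ltn_ord.
  rewrite IH// -!EFinM -EFinB; congr EFin.
  rewrite lt_cdf_unit//; move: (k`!%:R^-1)%R => c; ring.
rewrite integralB//=; [|exact: integrableZl..].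
rewrite !integralZl// I1 I2 -!EFinM -EFinB lt_cdf_unit//; congr EFin.
have kE : (k.+1`!%:R^-1 = k`!%:R^-1 / k.+1%:R :> R)%R.
  by rewrite factS natrM invfM mulrC.
rewrite kE; move: (k`!%:R^-1)%R (k.+1%:R^-1)%R => c c'; ring.
Qed.

End iterated_density.

(** * The probability integral transform *)

Section probability_integral_transform.
Local Open Scope ereal_scope.
Context d (T : measurableType d) (R : realType) (P : probability T R).
Variable X : {RV P >-> R}.
Local Notation F := (marginal_cdf X).
Local Notation leb := (@lebesgue_measure R).
Local Notation J := (`]0%R, 1%R[%classic : set R).

Lemma measurable_RV_le x : measurable [set w | (X w <= x)%R].
Proof.
rewrite (_ : [set w | _] = setT `&` X @^-1` `]-oo, x]%classic).
  by apply: measurable_funP => //; exact: measurable_itv.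
by rewrite setTI; apply/seteqP; split=> w /=; rewrite in_itv.
Qed.

Lemma measurable_RV_lt x : measurable [set w | (X w < x)%R].
Proof.
rewrite (_ : [set w | _] = setT `&` X @^-1` `]-oo, x[%classic).
  by apply: measurable_funP => //; exact: measurable_itv.
by rewrite setTI; apply/seteqP; split=> w /=; rewrite in_itv.
Qed.

Lemma marginal_cdfE x : (F x)%:E = P [set w | (X w <= x)%R].
Proof.
rewrite /marginal_cdf /cdf /distribution /pushforward.
have -> : X @^-1` `]-oo, x]%classic = [set w | (X w <= x)%R].
  by apply/seteqP; split=> w /=; rewrite in_itv.
by rewrite fineK// fin_num_measure//; exact: measurable_RV_le.
Qed.

Lemma marginal_cdf_cdfE x : (F x)%:E = cdf X x.
Proof. by rewrite fineK// fin_num_measure. Qed.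

Lemma marginal_cdf_nd : nondecreasing_fun F.
Proof. by move=> x y xy; rewrite -lee_fin !marginal_cdf_cdfE cdf_nondecreasing. Qed.

Lemma marginal_cdf_ge0 x : (0 <= F x)%R.
Proof. exact: fine_ge0. Qed.

Lemma marginal_cdf_le1 x : (F x <= 1)%R.
Proof. by rewrite -lee_fin marginal_cdf_cdfE cdf_le1. Qed.

Lemma measurable_marginal_cdf : measurable_fun setT F.
Proof. by apply: nondecreasing_measurable => //; exact: marginal_cdf_nd. Qed.

Lemma measurable_cdf_transform : measurable_fun setT (fun w => F (X w)).
Proof. by apply: measurableT_comp => //; exact: measurable_marginal_cdf. Qed.

Hypothesis atomless : forall x, P [set w | X w = x] = 0.

Lemma atomless_lt x : P [set w | (X w < x)%R] = (F x)%:E.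
Proof.
rewrite marginal_cdfE.
have -> : [set w | (X w <= x)%R] = [set w | (X w < x)%R] `|` [set w | X w = x].
  apply/seteqP; split=> w /=.
    by rewrite le_eqVlt => /orP[/eqP|]; [right|left].
  by case=> [/ltW//|->].
have mx : measurable [set w | X w = x].
  rewrite (_ : [set w | _] = setT `&` X @^-1` [set x]); last by rewrite setTI.
  exact: measurable_funP.
rewrite measureU//; [|exact: measurable_RV_lt|].
  by rewrite [X in _ = _ + X]atomless adde0.
by apply/seteqP; split=> w //= [+ wx]; rewrite wx ltxx.
Qed.

(** The supremum of the set where [F] is below [u] works: absence of atoms makes [F] left-continuous
    there, and right-continuity excludes a value below [u]. *)
Lemma quantile_exists u : (0 < u < 1)%R -> exists z, F z = u.
Proof.
move=> /andP[u0 u1].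
pose S : set R := [set x | (F x < u)%R].
have S0 : S !=set0.
  have /fine_cvgP[_] := cvg_cdfNy0 X.
  move=> /cvgr_lt /(_ _ u0) [M [_ HM]].
  by exists (M - 1)%R; apply: HM; rewrite ltrBlDr ltrDl.
have [y yu] : exists y, (u < F y)%R.
  have /fine_cvgP[_] := cvg_cdfy1 X.
  move=> /cvgr_gt /(_ _ u1) [M [_ HM]].
  by exists (M + 1)%R; apply: HM; rewrite ltrDl.
have ubS : ubound S y.
  move=> x xS; rewrite leNgt; apply/negP => /ltW yx.
  have := lt_trans xS yu; rewrite ltNge => /negP; apply.
  exact: marginal_cdf_nd.
have hS : has_sup S by split => //; exists y.
exists (sup S); apply/eqP; rewrite eq_le; apply/andP; split.
  (* These events increase to X < sup S, and each has probability at most [u]. *)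
  pose A n := [set w | (X w <= sup S - n.+1%:R^-1)%R].
  have mA n : measurable (A n) by exact: measurable_RV_le.
  have -> : (F (sup S) <= u)%R = (P (\bigcup_n A n) <= u%:E).
    rewrite -lee_fin -atomless_lt; congr (P _ <= _).
    apply/seteqP; split=> w /=; last first.
      by move=> [n _] /le_lt_trans; apply; rewrite ltrBlDr ltrDl invr_gt0.
    rewrite -subr_gt0 => /ltr_add_invr[n].
    rewrite add0r => /ltW nX; exists n => //; rewrite /A /=.
    by rewrite lerBrDr addrC -lerBrDr.
  have : P \o A @ \oo --> P (\bigcup_n A n).
    apply: nondecreasing_cvg_mu => //; first exact: bigcupT_measurable.
    move=> n m nm; apply/subsetPset => w; rewrite /A /= => /le_trans; apply.
    by rewrite lerD2l lerN2 lef_pV2 ?posrE// ler_nat.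
  move=> /cvg_lim <- //; apply: lime_le.
    apply: ereal_nondecreasing_is_cvgn => n m nm.
    rewrite le_measure ?inE//; move=> w; rewrite /A /= => /le_trans; apply.
    by rewrite lerD2l lerN2 lef_pV2 ?posrE// ler_nat.
  near=> n; rewrite /= -marginal_cdfE lee_fin.
  have /(sup_adherent) /(_ hS)[x xS] : (0 < n.+1%:R^-1 :> R)%R.
    by rewrite invr_gt0.
  by move=> /ltW /marginal_cdf_nd /le_trans; apply; exact: ltW.
rewrite leNgt; apply/negP => zu.
have /fine_cvgP[_] : cdf X x @[x --> (sup S)^'+] --> (F (sup S))%:E.
  by rewrite marginal_cdf_cdfE; exact: cdf_right_continuous.
move=> /cvgr_lt /(_ _ zu) Hx.
have [x xS xu] : exists2 x, (sup S < x)%R & (F x < u)%R.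
  near (sup S)^'+ => x; exists x; first by near: x; exact: nbhs_right_gt.
  by near: x.
have : (x <= sup S)%R by apply: (ub_le_sup hS.2).
by rewrite leNgt xS.
Unshelve. all: by end_near. Qed.

(** [F] may be flat, so the event is squeezed between rays: X <= z with F(z) = u above, X <= z with
    F(z) = u - e below, for every small e. The value u = 1 may have no quantile; there the upper
    bound is trivial. *)
Lemma cdf_transform_lt u : (0 < u <= 1)%R ->
  P [set w | (F (X w) < u)%R] = u%:E.
Proof.
move=> /andP[u0 u1].
have mV c : measurable [set w | (F (X w) < c)%R].
  rewrite (_ : [set w | _] = setT `&` (fun w => F (X w)) @^-1` `]-oo, c[%classic).
    by apply: measurable_cdf_transform => //; exact: measurable_itv.
  by rewrite setTI; apply/seteqP; split=> w /=; rewrite in_itv.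
apply/eqP; rewrite eq_le; apply/andP; split.
  have [->|u1'] := eqVneq u 1%R; first exact: probability_le1.
  have [|z zu] := @quantile_exists u; first by rewrite u0 lt_neqAle u1' u1.
  rewrite -zu marginal_cdfE le_measure ?inE//; first exact: measurable_RV_le.
  move=> w /=; apply: contraTT; rewrite -ltNge -leNgt => /ltW.
  exact: marginal_cdf_nd.
rewrite -[leRHS]fineK ?fin_num_measure// lee_fin; apply/ler_addgt0Pr => e e0.
have [ue|ue] := leP u e.
  by rewrite (le_trans ue)// lerDr fine_ge0.
rewrite -lerBlDr -lee_fin fineK ?fin_num_measure//.
have [|z zu] := @quantile_exists (u - e)%R.
  by rewrite subr_gt0 ue (lt_le_trans _ u1)// ltrBlDr ltrDl.
rewrite -zu marginal_cdfE le_measure ?inE//; first exact: measurable_RV_le.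
move=> w /= /marginal_cdf_nd /le_lt_trans; apply.
by rewrite zu ltrBlDr ltrDl.
Qed.

(** Open rays are stable under intersection and generate the Borel sets, so their probabilities
    determine the law. *)
Lemma cdf_transform_law (A : set R) : measurable A ->
  P ((fun w => F (X w)) @^-1` A) = leb (A `&` J).
Proof.
move=> mA.
have mJ : measurable J by exact: measurable_itv.
have mV : measurable_fun setT (fun w => F (X w) : measurableTypeR R).
  exact: measurable_cdf_transform.
pose m1 : {measure set (measurableTypeR R) -> \bar R} :=
  restricted_law P mV measurableT.
pose m2 : {measure set (measurableTypeR R) -> \bar R} := mrestr leb mJ.
rewrite -[LHS](congr1 P (setIT _)) -[LHS]/(m1 A) -[RHS]/(m2 A).
apply: (@measure_unique _ _ (measurableTypeR R) (@RGenInftyO.G R)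
  (fun k => `]-oo, k%:R[%classic)) => //.
- exact: RGenInftyO.measurableE.
- move=> _ _ [x ->] [y ->]; exists (Num.min x y).
  by apply/seteqP; split=> z /=; rewrite !in_itv/= lt_min => /andP.
- by move=> k; exists k%:R.
- apply/seteqP; split=> // x _; exists (Num.trunc `|x|).+1 => //=.
  rewrite in_itv/= (le_lt_trans (ler_norm x))//.
  exact: truncnS_gt.
- move=> _ [u ->]; rewrite -[RHS]/(leb (`]-oo, u[%classic `&` J)).
  rewrite /m1 /= /restricted_law setIT.
  have -> : (fun w => F (X w)) @^-1` `]-oo, u[%classic =
      [set w | (F (X w) < u)%R].
    by apply/seteqP; split=> w /=; rewrite in_itv.
  have [u0|u0] := leP u 0%R.
    rewrite (_ : [set w | (F (X w) < u)%R] = set0) ?measure0; last first.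
      apply/seteqP; split=> w //=.
      by rewrite ltNge (le_trans u0)// marginal_cdf_ge0.
    rewrite (_ : `]-oo, u[%classic `&` J = set0) ?measure0//.
    apply/seteqP; split=> x //=; rewrite !in_itv/= => -[xu /andP[x0 _]].
    by have := lt_trans x0 (lt_le_trans xu u0); rewrite ltxx.
  have [u1|u1] := leP u 1%R.
    rewrite cdf_transform_lt ?u0//.
    rewrite (_ : `]-oo, u[%classic `&` J = `]0%R, u[%classic).
      by rewrite lebesgue_measure_itv/= lte_fin u0 -EFinB subr0.
    apply/seteqP; split => x /=; rewrite !in_itv/=.
      by move=> [-> /andP[->]].
    by move=> /andP[-> xb]; rewrite xb (lt_le_trans xb).
  rewrite (_ : [set w | (F (X w) < u)%R] = setT) ?probability_setT; last first.
    apply/seteqP; split=> w //= _.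
    by rewrite (le_lt_trans _ u1)// marginal_cdf_le1.
  rewrite (_ : `]-oo, u[%classic `&` J = `]0%R, 1%R[%classic).
    by rewrite lebesgue_measure_itv/= lte_fin ltr01 -EFinB subr0.
  apply/seteqP; split => x /=; rewrite !in_itv/=; first by case.
  by move=> /andP[-> x1]; rewrite x1 (lt_trans x1).
- move=> k; rewrite /m1 /= /restricted_law setIT ltey_eq fin_num_measure//.
  by rewrite -[X in measurable X]setTI; exact: (measurable_cdf_transform).
Qed.

End probability_integral_transform.

(** * Conditional probabilities as densities *)

(** Change of variables for an image measure, the restriction to [G] being the density [\1_G] with
    respect to [Q]. *)
Lemma ge0_integral_restricted_law d d' (T : measurableType d)
    (U : measurableType d') (R : realType) (Q : probability T R) (V : T -> U)
    (G : set T) (mV : measurable_fun setT V) (mG : measurable G)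
    (f : U -> \bar R) :
  measurable_fun setT f -> (forall x, 0 <= f x)%E ->
  (\int[restricted_law Q mV mG]_x f x = \int[Q]_(w in G) f (V w))%E.
Proof.
move=> mf f0.
transitivity (\int[pushforward (mrestr Q mG) V]_x f x)%E.
  exact: eq_measure_integral.
rewrite (ge0_integral_pushforward mV)//.
have mfV : measurable_fun setT (f \o V) by exact: measurableT_comp.
rewrite preimage_setT (@ge0_integral_density _ _ _ Q (mrestr Q mG)
  (fun w => (\1_G w)%:E))//; first last.
- by move=> x /=; exact: f0.
- by move=> A mA; rewrite /mrestr integral_indic// setIC.
- by apply/measurable_EFinP; exact: measurable_indic.
rewrite [RHS]integral_mkcond; apply: eq_integral => w _ /=.
by rewrite patchE indicE; case: ifP => _; rewrite (mule1, mule0).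
Qed.

Section cond_prob_density.
Local Open Scope ereal_scope.
Context d (T : measurableType d) (R : realType) (P : probability T R).
Local Notation leb := (@lebesgue_measure R).
Local Notation J := (`]0%R, 1%R[%classic : set R).
Variables (V : T -> R) (A : set T) (g : R -> R).
Hypotheses (mV : measurable_fun setT V) (mA : measurable A).
Hypothesis lawV : forall S : set R, measurable S ->
  P (V @^-1` S) = leb (S `&` J).
Hypothesis gP : cond_prob_version P A V g.

Let mV' : measurable_fun setT (V : T -> measurableTypeR R).
Proof. exact: mV. Qed.

Let mVS (S : set R) : measurable S -> measurable (V @^-1` S).
Proof. by move=> mS; rewrite -[X in measurable X]setTI; exact: mV. Qed.

Let mg : measurable_fun setT g. Proof. by case: gP. Qed.

Let mgV : measurable_fun setT (fun w => g (V w)).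
Proof. exact: measurableT_comp. Qed.

Let N := [set x | (g x < 0)%R].

Let mN : measurable N.
Proof.
rewrite (_ : N = setT `&` g @^-1` `]-oo, 0%R[%classic).
  by apply: mg => //; exact: measurable_itv.
by rewrite setTI; apply/seteqP; split=> x /=; rewrite in_itv.
Qed.

(** The defining property of a version, taken at [N], makes the integral of [g (V w)] over this
    event a probability. *)
Let PN : P (V @^-1` N) = 0.
Proof.
apply: measure_negligible; first exact: mVS.
rewrite -[X in P.-negligible X]setTI; apply: negligible_neg => //.
by rewrite setTI -[X in 0 <= X](gP.2 N mN).
Qed.

Let gp x := Num.max (g x) 0%R.

Let mgp : measurable_fun setT gp.
Proof. exact: measurable_maxr. Qed.

Let gp0 x : (0 <= gp x)%R.
Proof. by rewrite le_max lexx orbT. Qed.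

Let gpE (S : set R) : measurable S ->
  P (A `&` V @^-1` S) = \int[leb]_(x in S `&` J) (gp x)%:E.
Proof.
move=> mS; rewrite gP.2//.
transitivity (\int[P]_(w in V @^-1` S) (gp (V w))%:E).
  apply: ae_eq_integral.
  - exact: mVS.
  - by apply/measurable_EFinP; exact: measurable_funTS.
  - apply/measurable_EFinP; apply: measurable_funTS.
    exact: measurableT_comp.
  exists (V @^-1` N); split => //; first exact: mVS.
  move=> w /= /not_implyP[Sw ne]; rewrite /N /= ltNge; apply/negP => g0.
  by apply: ne; rewrite /gp max_l.
have mgpS : measurable_fun setT ((EFin \o gp) \_ S).
  apply/(measurable_restrictT _ _).1 => //.
  by apply/measurable_EFinP; exact: measurable_funTS.
have gpS0 x : 0 <= ((EFin \o gp) \_ S) x.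
  by rewrite patchE; case: ifP => //= _; rewrite lee_fin.
have <- : \int[restricted_law P mV' measurableT]_x ((EFin \o gp) \_ S) x =
    \int[P]_(w in V @^-1` S) (gp (V w))%:E.
  rewrite ge0_integral_restricted_law// [RHS]integral_mkcond.
  apply: eq_integral => w _; rewrite !patchE.
  by congr (if _ then _ else _); apply/idP/idP; rewrite !inE.
rewrite (@ge0_integral_density _ _ _ leb (restricted_law P mV' measurableT)
  (fun w => (\1_J w)%:E))//; first last.
- move=> B mB; rewrite -[LHS]/(P (V @^-1` B `&` setT)) setIT lawV//.
  by rewrite integral_indic// setIC.
- by apply/measurable_EFinP; exact: measurable_indic.
rewrite [RHS]integral_mkcond; apply: eq_integral => x _ /=.
rewrite !patchE indicE in_setI; case: (x \in S); last by rewrite mul0e.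
by case: (x \in J); rewrite (mule1, mule0).
Qed.

(** The part outside [A] is what remains of the uniform mass of [S] once the part in [A] is removed.
    The positive part [gp] permits the change of variables from [P] to Lebesgue measure; it differs
    from [g] on [J] only by a null set. *)
Lemma cond_prob_density (S : set R) : measurable S ->
  P (V @^-1` S `&` ~` A) = \int[leb]_(x in S `&` J) (1 - g x)%:E.
Proof.
move=> mS.
have mSJ : measurable (S `&` J) by apply: measurableI => //.
have lebSJ : leb (S `&` J) \is a fin_num.
  by rewrite -lawV// fin_num_measure//; exact: mVS.
transitivity (\int[leb]_(x in S `&` J) (1%:E - (gp x)%:E)); last first.
  apply: ae_eq_integral => //.
  - by apply/measurable_EFinP; apply: measurable_funB => //; exact: measurable_funTS.
  - by apply/measurable_EFinP; apply: measurable_funB => //; exact: measurable_funTS.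
  exists (N `&` J); split; [exact: measurableI|by rewrite -PN; exact/esym/lawV|].
  move=> x /= /not_implyP[[Sx Jx] ne]; split=> //.
  rewrite /N /= ltNge; apply/negP => g0.
  by apply: ne; rewrite /gp max_l.
rewrite integralB_EFin//; last 2 first.
- apply/integrableP; split; first exact/measurable_EFinP.
  by rewrite /= normr1 integral_cst// mul1e ltey_eq lebSJ.
- apply/integrableP; split.
    by apply/measurable_EFinP; exact: measurable_funTS.
  have -> : \int[leb]_(x in S `&` J) `|(gp x)%:E| =
      \int[leb]_(x in S `&` J) (gp x)%:E.
    by apply: eq_integral => x _; rewrite /= ger0_norm.
  rewrite -gpE// ltey_eq fin_num_measure//.
  by apply: measurableI => //; exact: mVS.
rewrite integral_cst// mul1e -gpE//.
transitivity (P (V @^-1` S) - P (A `&` V @^-1` S)); last by rewrite lawV.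
rewrite -setDE measureD// 1?setIC//; first exact: mVS.
by rewrite ltey_eq fin_num_measure//; exact: mVS.
Qed.

End cond_prob_density.

(** * A continuous joint distribution function has atomless marginals *)

Section continuous_joint_cdf.
Local Open Scope ereal_scope.
Context d (T : measurableType d) (R : realType) (P : probability T R).

(** For x < a, the event A = a, B <= b has probability at most the increment of the joint
    distribution function from x to a, which tends to 0. A countable union over integers b then
    removes the condition on [B]. *)
Let atomless_slice (A B : {RV P >-> R}) (a : R) :
  (forall b, {for a, continuous (fun a =>
    fine (P [set w | (A w <= a)%R /\ (B w <= b)%R]))}) ->
  P [set w | A w = a] = 0.
Proof.
move=> cG.
have mAa : measurable [set w | A w = a].
  rewrite (_ : [set w | _] = setT `&` A @^-1` [set a]); last by rewrite setTI.
  exact: measurable_funP.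
have mAB x y : measurable [set w | (A w <= x)%R /\ (B w <= y)%R].
  by apply: measurableI; exact: measurable_RV_le.
have mE b : measurable ([set w | A w = a] `&` [set w | (B w <= b)%R]).
  by apply: measurableI => //; exact: measurable_RV_le.
have E0 b : P ([set w | A w = a] `&` [set w | (B w <= b)%R]) = 0.
  apply/eqP; rewrite -measure_le0; apply/lee_addgt0Pr => e e0.
  rewrite add0e.
  have /cvgr_dist_lt /(_ _ e0) near_a := cG b.
  have [x xa Hx] : exists2 x, (x < a)%R & (`|
      fine (P [set w | (A w <= a)%R /\ (B w <= b)%R]) -
      fine (P [set w | (A w <= x)%R /\ (B w <= b)%R])| < e)%R.
    near a^'- => x; exists x; first by near: x; exact: nbhs_left_lt.
    by near: x; exact: cvg_within.
  have : P ([set w | A w = a] `&` [set w | (B w <= b)%R]) +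
      P [set w | (A w <= x)%R /\ (B w <= b)%R] <=
      P [set w | (A w <= a)%R /\ (B w <= b)%R].
    rewrite -measureU//.
      rewrite le_measure ?inE//; first exact: measurableU.
      move=> w /= [[-> //]|[Ax Bb]]; split => //.
      by rewrite (le_trans Ax)// ltW.
    apply/seteqP; split=> w //= [[-> _] [+ _]].
    by rewrite leNgt xa.
  rewrite -leeBrDr ?fin_num_measure// => /le_trans; apply.
  rewrite -[X in X - _]fineK ?fin_num_measure//.
  rewrite -[X in _ - X]fineK ?fin_num_measure// -EFinB lee_fin.
  by rewrite (le_trans (ler_norm _))// ltW.
apply: measure_negligible => //.
apply: (@negligibleS _ _ _ _ (\bigcup_n
    ([set w | A w = a] `&` [set w | (B w <= n%:R)%R]))).
  move=> w /= Aw; exists (Num.trunc `|B w|).+1 => //; split=> //=.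
  by rewrite (le_trans (ler_norm _))// ltW// truncnS_gt.
by apply: negligible_bigcup => n; apply/negligibleP; [exact: mE|exact: E0].
Unshelve. all: by end_near. Qed.

Variables Z X : {RV P >-> R}.
Hypothesis hcont : continuous (joint_cdf Z X).

Lemma joint_cdf_atomless1 z : P [set w | Z w = z] = 0.
Proof.
apply: (@atomless_slice Z X) => b.
apply: (@continuous_comp _ _ _ (fun a : R => (a, b)) (joint_cdf Z X)).
  by move=> /=; exact: (cvg_pair (f := id) (g := cst b) cvg_id (cvg_cst b)).
exact: hcont.
Qed.

Lemma joint_cdf_atomless2 x : P [set w | X w = x] = 0.
Proof.
apply: (@atomless_slice X Z) => b.
rewrite (_ : (fun _ => _) = (joint_cdf Z X \o (fun a : R => (b, a)))).
  apply: continuous_comp; last exact: hcont.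
  by move=> /=; exact: (cvg_pair (f := cst b) (g := id) (cvg_cst b) cvg_id).
apply/funext => a; rewrite /joint_cdf /=; congr (fine (P _)).
by apply/seteqP; split=> w [].
Qed.

End continuous_joint_cdf.

(** * Order statistics as configurations of a pivot and the indices below it *)

Section order_statistics.
Context (T : Type) (R : realType) (n : nat).
Variables (Zs Xs : 'I_n -> T -> R).

(** Strictness on both sides leaves no index tied with the pivot [k]. *)
Definition below (w : T) (k : 'I_n) (S : {set 'I_n}) : Prop :=
  [/\ k \notin S, forall i, i \in S -> Zs i w < Zs k w &
      forall i, i \notin S -> i != k -> Zs k w < Zs i w].

Lemma concomitantE w i j : injective (Zs^~ w) ->
  order_stat Zs i w = Zs j w -> concomitant Zs Xs i w = Xs j w.
Proof.
move=> inj oE; rewrite /concomitant oE index_map//.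
by rewrite (nth_map j) ?index_mem ?mem_enum// nth_index// mem_enum.
Qed.

(** The sorted sample is the sorted list over [k |: S] followed by the rest, so the first [#|S|.+1]
    concomitants are the X-values over [k |: S] in some order; success depends only on this set of
    values. *)
Lemma concomitant_below w k S y : injective (Zs^~ w) -> below w k S ->
  (exists2 i, (i < #|S|.+1)%N & concomitant Zs Xs i w = y) <->
  (exists2 j, j \in k |: S & Xs j w = y).
Proof.
move=> inj [kS Sk Sk'].
pose lo := sort <=%R [seq Zs j w | j <- enum (k |: S)].
pose hi := sort <=%R [seq Zs j w | j <- enum (~: (k |: S))].
have slo : size lo = #|S|.+1.
  by rewrite size_sort size_map -cardE cardsU1 kS.
have sE : sort <=%R [seq Zs j w | j <- enum 'I_n] = lo ++ hi.
  apply: (@sorted_eq _ <=%R); [exact: le_trans|exact: le_anti| | |].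
  - exact: sort_le_sorted.
  - rewrite (sorted_pairwise le_trans) pairwise_cat.
    rewrite -!(sorted_pairwise le_trans) !sort_le_sorted !andbT.
    apply/allrelP => a b; rewrite !mem_sort => /mapP[i + ->] /mapP[j + ->].
    rewrite !mem_enum finset.in_setC !finset.in_setU1 negb_or => iL /andP[jk jS].
    apply/ltW; apply: le_lt_trans (Sk' j jS jk).
    by case/orP: iL => [/eqP->//|/Sk /ltW].
  - rewrite perm_sort perm_sym.
    rewrite (perm_trans (y := [seq Zs j w | j <- enum (k |: S)] ++
        [seq Zs j w | j <- enum (~: (k |: S))]))//.
      by apply: perm_cat; rewrite perm_sort.
    rewrite -map_cat; apply: perm_map; apply: uniq_perm.
    + rewrite cat_uniq !enum_uniq andbT /=; apply/hasPn => i.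
      by rewrite !mem_enum finset.in_setC.
    + exact: enum_uniq.
    + by move=> i; rewrite mem_cat !mem_enum finset.in_setC orbN.
have oE i : (i < #|S|.+1)%N -> order_stat Zs i w = lo`_i.
  by move=> iS; rewrite /order_stat sE nth_cat slo iS.
split=> [[i iS <-]|[j jL <-]].
  have : lo`_i \in lo by rewrite mem_nth// slo.
  rewrite mem_sort => /mapP[j]; rewrite mem_enum => jL; rewrite -oE// => oj.
  by exists j => //; rewrite (concomitantE inj oj).
have jlo : Zs j w \in lo.
  by rewrite mem_sort; apply/mapP; exists j => //; rewrite mem_enum.
exists (index (Zs j w) lo); first by rewrite -slo index_mem.
apply: concomitantE => //; rewrite oE ?nth_index//.
by rewrite -slo index_mem.
Qed.

(** Sending [k] to the number of smaller values is an injection of ['I_n] into itself, hence a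
    bijection, and so takes the value [l]. *)
Lemma below_exists w l : injective (Zs^~ w) -> (l < n)%N ->
  exists k S, below w k S /\ #|S| = l.
Proof.
move=> inj ln.
pose B k : {set 'I_n} := [set i | Zs i w < Zs k w]%SET.
have kB k : k \notin B k by rewrite inE ltxx.
have Bn k : (#|B k| < n)%N.
  have := subset_leq_card (finset.subsetT (k |: B k)).
  by rewrite cardsU1 kB cardsT card_ord.
pose r k := Ordinal (Bn k).
have rlt i j : Zs i w < Zs j w -> (r i < r j)%N.
  move=> ij; apply: proper_card; apply/properP; split.
    by apply/fintype.subsetP => a; rewrite !inE => /lt_trans; apply.
  by exists i; rewrite inE// ltxx.
have rinj : injective r.
  move=> i j rij; apply: inj; case: (ltgtP (Zs i w) (Zs j w)) => // /rlt.
    by rewrite rij ltnn.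
  by rewrite rij ltnn.
have [r' r'K rK] := injF_bij rinj.
exists (r' (Ordinal ln)), (B (r' (Ordinal ln))); split; last first.
  by have /(congr1 val) := rK (Ordinal ln).
split=> // [i|i]; first by rewrite inE.
rewrite inE -leNgt le_eqVlt => /orP[/eqP/inj <-|//].
by rewrite eqxx.
Qed.

(** The pivot determines [S], and the cardinal of [S] increases strictly with the value at the
    pivot. *)
Lemma below_unique w k S k' S' : injective (Zs^~ w) ->
  below w k S -> below w k' S' -> #|S| = #|S'| -> k = k' /\ S = S'.
Proof.
move=> inj.
have bE k0 S0 : below w k0 S0 -> S0 = [set i | Zs i w < Zs k0 w]%SET.
  move=> [kS Sk Sk']; apply/setP => i; rewrite inE.
  apply/idP/idP => [/Sk//|ik]; apply: contraLR ik => iS.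
  have [->|ik] := eqVneq i k0; first by rewrite ltxx.
  by rewrite -leNgt ltW// Sk'.
have lt k0 S0 k1 S1 : below w k0 S0 -> below w k1 S1 ->
    Zs k0 w < Zs k1 w -> (#|S0| < #|S1|)%N.
  move=> /bE -> /bE -> lt01; apply: proper_card; apply/properP; split.
    by apply/fintype.subsetP => a; rewrite !inE => /lt_trans; apply.
  by exists k0; rewrite inE// ltxx.
move=> b b' SS'.
have kk' : k = k'.
  apply: inj; case: (ltgtP (Zs k w) (Zs k' w)) => // [/(lt _ _ _ _ b b')|].
    by rewrite SS' ltnn.
  by move=> /(lt _ _ _ _ b' b); rewrite SS' ltnn.
by split=> //; rewrite (bE _ _ b) (bE _ _ b') kk'.
Qed.

(* For measurability in the presence of ties: the position selected by
   [concomitant] depends on [w] only through finitely many comparisons. *)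
Definition comparisons (w : T) : {ffun 'I_n * 'I_n -> bool} :=
  [ffun p => Zs p.1 w <= Zs p.2 w].

(** Here [a] is an index attaining the order statistic; comparison in both directions encodes
    equality of values, so [find] reproduces the choice made by [index]. *)
Definition selected_position (k0 : 'I_n) (c : {ffun 'I_n * 'I_n -> bool})
    (i : nat) : nat :=
  let a := nth k0 (sort (fun p q => c (p, q)) (enum 'I_n)) i in
  find (fun k => c (k, a) && c (a, k)) (enum 'I_n).

Lemma concomitant_selected (k0 : 'I_n) i w : (i < n)%N ->
  concomitant Zs Xs i w =
  [seq Xs k w | k <- enum 'I_n]`_(selected_position k0 (comparisons w) i).
Proof.
move=> i_n; rewrite /concomitant; congr (_`_ _).
have -> : order_stat Zs i w = Zs (nth k0
    (sort (fun p q => comparisons w (p, q)) (enum 'I_n)) i) w.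
  rewrite /order_stat sort_map (nth_map k0).
    by congr (Zs (nth _ (sort _ _) _) w); apply/funext => p; apply/funext => q;
      rewrite ffunE.
  by rewrite size_sort size_enum_ord.
rewrite /index find_map; apply: eq_find => k /=.
by rewrite !ffunE /= eq_le.
Qed.

End order_statistics.

(** * Measurability of the selection *)

Section selection_measurability.
Context d (T : measurableType d) (R : realType) (Q : probability T R) (n : nat).
Variables (Zs Xs : 'I_n -> {RV Q >-> R}).

Lemma measurable_RV2_le (Y Y' : {RV Q >-> R}) :
  measurable [set w | Y w <= Y' w].
Proof.
have /= := @measurable_fun_ler _ _ _ setT Y Y' _ _ measurableT [set true].
rewrite setTI (_ : _ @^-1` [set true] = [set w | Y w <= Y' w]); first exact.
by apply/seteqP; split => w /=.
Qed.

Lemma measurable_comparisons (c : {ffun 'I_n * 'I_n -> bool}) :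
  measurable [set w | comparisons Zs w = c].
Proof.
have -> : [set w | comparisons Zs w = c] =
    \bigcap_(p in [set: 'I_n * 'I_n])
      (if c p then [set w | Zs p.1 w <= Zs p.2 w]
       else ~` [set w | Zs p.1 w <= Zs p.2 w]).
  apply/seteqP; split=> [w /= <- p _|w Hw].
    by rewrite ffunE; case: ifPn => //= /negP.
  apply/ffunP => p; rewrite ffunE; have := Hw p I.
  by case: (c p) => //= /negP/negbTE.
apply: fin_bigcap_measurable => [|p _]; first exact: finite_finset.
by case: (c p); [|apply: measurableC]; exact: measurable_RV2_le.
Qed.

(** On each of the finitely many cells where [comparisons] is constant, the concomitant is one fixed
    [Xs p], or the default 0 when the position is out of range. *)
Lemma measurable_concomitant_le (i : nat) (t : \bar R) : (i < n)%N ->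
  measurable [set w | ((concomitant Zs Xs i w)%:E <= t)%E].
Proof.
move=> i_n; pose k0 := Ordinal i_n.
pose f c w := [seq Xs k w | k <- enum 'I_n]`_(selected_position k0 c i).
have fE w : concomitant Zs Xs i w = f (comparisons Zs w) w.
  exact: concomitant_selected.
have -> : [set w | ((concomitant Zs Xs i w)%:E <= t)%E] =
    \bigcup_(c in [set: {ffun 'I_n * 'I_n -> bool}])
      ([set w | comparisons Zs w = c] `&` [set w | ((f c w)%:E <= t)%E]).
  apply/seteqP; split=> [w /= Hw|w [c _ [/= <-]]].
    by exists (comparisons Zs w) => //; split => //=; rewrite -fE.
  by rewrite /= -fE.
apply: fin_bigcup_measurable => [|c _]; first exact: finite_finset.
apply: measurableI; first exact: measurable_comparisons.
have mf : measurable_fun setT (f c).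
  rewrite /f; move: (selected_position _ _ _) => p.
  have [pn|pn] := ltnP p n; last first.
    rewrite (_ : (fun _ => _) = cst 0)//; apply/funext => w.
    by rewrite nth_default// size_map size_enum_ord.
  rewrite (_ : (fun _ => _) = Xs (Ordinal pn))//; apply/funext => w.
  rewrite (nth_map k0) ?size_enum_ord//; congr (Xs _ w).
  exact: (nth_ord_enum k0 (Ordinal pn)).
have := @measurable_fun_lee _ _ _ setT (EFin \o f c) (cst t) _ _ measurableT
  [set true].
rewrite setTI => H; rewrite (_ : mkset _ =
    (fun w => ((f c w)%:E <= t)%E) @^-1` [set true]).
  by apply: H => //; exact/measurable_EFinP.
by apply/seteqP; split => w /=.
Qed.

End selection_measurability.

(** * The probability of one configuration *)

Section pivot_event.
Local Open Scope ereal_scope.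
Context (R : realType) d (T : measurableType d) (P : probability T R).
Variables (Z X : {RV P >-> R}).
Hypothesis Z0 : forall z, P [set w | Z w = z] = 0.
Local Notation F := (marginal_cdf Z).
Local Notation leb := (@lebesgue_measure R).

Let mV : measurable_fun setT (fun w => F (Z w) : measurableTypeR R).
Proof. exact: measurable_cdf_transform. Qed.

Let mX (G : set R) : measurable G -> measurable (X @^-1` G).
Proof. by move=> mG; rewrite -[X in measurable X]setTI; exact: measurable_funP. Qed.

(** The law of V = F_Z(Z) on the event X in [G]. The whole line gives the uniform law; the values
    above the threshold give the measure with distribution function H. *)
Definition rank_law (G : set R) (mG : measurable G) :
    {finite_measure set (measurableTypeR R) -> \bar R} :=
  restricted_law P mV (mX mG).

(** The events Z < z and F(Z) < F(z) differ only where F(Z) = F(z); this can occur on a flat piece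
    of [F], but is null because F(Z) is uniform. *)
Lemma lt_cdf_rank_law G (mG : measurable G) z :
  P [set w | (Z w < z)%R /\ G (X w)] = (lt_cdf (rank_law mG) (F z))%:E.
Proof.
rewrite lt_cdfE.
have mZ : measurable [set w | (Z w < z)%R /\ G (X w)].
  apply: (measurableI [set w | (Z w < z)%R]); first exact: measurable_RV_lt.
  exact: mX.
have mVS (S : set R) : measurable S -> measurable ((fun w => F (Z w)) @^-1` S).
  by move=> mS; rewrite -[X in measurable X]setTI; exact: mV.
pose A := (fun w => F (Z w)) @^-1` `]-oo, F z[%classic `&` X @^-1` G.
have mA : measurable A by apply: measurableI; [exact: mVS|exact: mX].
pose N := (fun w => F (Z w)) @^-1` [set F z].
have mN : measurable N by exact: mVS.
have PN : P N = 0.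
  rewrite /N cdf_transform_law//; apply: (@subset_measure0 _ _ _ leb _ [set F z]).
  - by apply: measurableI.
  - by [].
  - exact: subIsetl.
  - exact: lebesgue_measure_set1.
change (P [set w | (Z w < z)%R /\ G (X w)] = P A).
apply/eqP; rewrite eq_le; apply/andP; split.
  apply: (@le_trans _ _ (P (A `|` N))); last by rewrite measureU0.
  rewrite le_measure ?inE//; first exact: measurableU.
  move=> w /= [Zz Gw]; have := marginal_cdf_nd Z (ltW Zz).
  rewrite le_eqVlt => /orP[/eqP|] Fz; [right|left] => //.
rewrite le_measure ?inE// => w [/=]; rewrite in_itv/= => Fz Gw; split=> //.
move: Fz; rewrite !ltNge; apply: contra; exact: marginal_cdf_nd.
Qed.

Let mZX : measurable_fun setT (fun w => (Z w, X w)).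
Proof. by apply: measurable_fun_pair; exact: measurable_funP. Qed.

Context d' (T' : measurableType d') (Q : probability T' R) (n : nat).
Variables (Zs Xs : 'I_n -> {RV Q >-> R}).
Hypothesis hiid : iid_copies Z X Zs Xs.

Let W (i : 'I_n) (w : T') : R * R := (Zs i w, Xs i w).

Let mW i : measurable_fun setT (W i).
Proof. by apply: measurable_fun_pair; exact: measurable_funP. Qed.

Let mu : {finite_measure set (R * R)%type -> \bar R} :=
  restricted_law P mZX measurableT.

Let muE A : mu A = P [set w | A (Z w, X w)].
Proof. by rewrite /mu /= /restricted_law setIT. Qed.

Let lawW i A : measurable A -> Q (W i @^-1` A) = mu A.
Proof. by move=> mA; rewrite muE -(hiid.2 i). Qed.

Let mlt : measurable [set p : (R * R) * (R * R) | (p.1.1 < p.2.1)%R].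
Proof.
have /= := @measurable_fun_ltr _ _ _ setT (fun p : (R * R) * (R * R) => p.1.1)
  (fun p => p.2.1) _ _ measurableT [set true].
rewrite setTI => H.
rewrite (_ : mkset _ = (fun p : (R * R) * (R * R) =>
  (p.1.1 < p.2.1)%R) @^-1` [set true]); last by apply/seteqP; split.
by apply: H => //; apply: measurableT_comp => //.
Qed.

Let mgt : measurable [set p : (R * R) * (R * R) | (p.2.1 < p.1.1)%R].
Proof.
have /= := @measurable_fun_ltr _ _ _ setT (fun p : (R * R) * (R * R) => p.2.1)
  (fun p => p.1.1) _ _ measurableT [set true].
rewrite setTI => H.
rewrite (_ : mkset _ = (fun p : (R * R) * (R * R) =>
  (p.2.1 < p.1.1)%R) @^-1` [set true]); last by apply/seteqP; split.
by apply: H => //; apply: measurableT_comp => //.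
Qed.

(** Take [i] as pivot and constrain [j] alone: the section at a fixed pivot is the event that Z
    equals a given value, which is null. *)
Lemma ties_null i j : i != j -> Q [set w | Zs i w = Zs j w] = 0.
Proof.
move=> ij.
pose D (a : 'I_n) : set ((R * R) * (R * R)) :=
  if a == j then ~` [set p | (p.1.1 < p.2.1)%R] `&`
                 ~` [set p | (p.2.1 < p.1.1)%R] else setT.
have mD a : measurable (D a).
  by rewrite /D; case: ifP => // _; apply: measurableI; exact: measurableC.
have := @pivot_integral _ _ _ _ _ Q _ W mW mu hiid.1 lawW i D setT mD measurableT.
rewrite preimage_setT setTI => E.
have -> : [set w | Zs i w = Zs j w] =
  \bigcap_(a in [set a | a != i]) [set w | D a (W i w, W a w)].
  apply/seteqP; split=> [w /= ZZ a _|w Dw /=].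
    rewrite /= /D; case: eqP => // -> /=; rewrite ZZ ltxx.
    by split.
  have := Dw j; rewrite /= /D eqxx eq_sym => /(_ ij)[/= /negP + /negP].
  by rewrite -!leNgt => ? ?; apply/eqP; rewrite eq_le; apply/andP.
rewrite E integral0_eq// => p _.
rewrite (bigD1 j) 1?eq_sym//= (_ : mu _ = 0) ?mul0e// muE.
rewrite -(Z0 p.1); congr (P _); apply/seteqP; split=> w /=.
  rewrite /xsection /= inE /D eqxx /= => -[/negP + /negP].
  by rewrite -!leNgt => ? ?; apply/eqP; rewrite eq_le; apply/andP.
rewrite /xsection /= inE /D eqxx /= => ->.
by rewrite ltxx.
Qed.

(** With the whole line for [G] this is the bare configuration; with the values above the threshold,
    a configuration on which the search fails. *)
Definition pivot_event (G : set R) (k : 'I_n) (S : {set 'I_n}) : set T' :=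
  [set w | below Zs w k S /\ forall i, i \in k |: S -> G (Xs i w)].

Let D (G : set R) (S : {set 'I_n}) (a : 'I_n) : set ((R * R) * (R * R)) :=
  if a \in S then [set p | (p.2.1 < p.1.1)%R] `&` (snd \o snd) @^-1` G
  else [set p | (p.1.1 < p.2.1)%R].

Let mD G S a : measurable G -> measurable (D G S a).
Proof.
move=> mG; rewrite /D; case: ifP => // _; apply: measurableI => //.
rewrite -[X in measurable X]setTI.
have ms : measurable_fun setT (fun p : (R * R) * (R * R) => p.2.2).
  exact: measurableT_comp.
exact: ms.
Qed.

Let pivot_eventE G k (S : {set 'I_n}) : k \notin S -> pivot_event G k S =
  W k @^-1` (snd @^-1` G) `&`
  \bigcap_(a in [set a | a != k]) [set w | D G S a (W k w, W a w)].
Proof.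
move=> kS; apply/seteqP; split=> [w [[_ lt gt] Gw]|w [Gk Dw]].
  split=> [|a ak] /=; first by apply: Gw; rewrite setU11.
  rewrite /D; case: ifPn => aS /=; last exact: gt.
  by split; [exact: lt|apply: Gw; rewrite setU1r].
split; first split=> // [i iS|i iS ik].
- have : D G S i (W k w, W i w).
    by apply: Dw => /=; apply: contraNneq kS => <-.
  by rewrite /D iS => -[].
- have : D G S i (W k w, W i w) by exact: Dw.
  by rewrite /D (negbTE iS).
move=> i; rewrite finset.in_setU1 => /orP[/eqP ->//|iS].
have : D G S i (W k w, W i w).
  by apply: Dw => /=; apply: contraNneq kS => <-.
by rewrite /D iS => -[].
Qed.

Let msnd (G : set R) : measurable G -> measurable (@snd R R @^-1` G).
Proof.
by move=> mG; rewrite -[X in measurable X]setTI; exact: measurable_snd.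
Qed.

Lemma measurable_pivot_event G k (S : {set 'I_n}) : measurable G -> k \notin S ->
  measurable (pivot_event G k S).
Proof.
move=> mG kS; rewrite pivot_eventE//; apply: measurableI.
  by rewrite -[X in measurable X]setTI; apply: mW => //; exact: msnd.
apply: fin_bigcap_measurable => [|a _]; first exact: finite_finset.
rewrite -[X in measurable X]setTI.
have mWW : measurable_fun setT (fun w => (W k w, W a w)).
  by apply: measurable_fun_pair; exact: mW.
by apply: mWW => //; exact: mD.
Qed.

(* The truncation at 0 makes the weight nonnegative on the whole line; the
   measures [rank_law] are carried by ]0, 1[. *)
Definition pivot_weight (rho : {finite_measure set (measurableTypeR R) -> \bar R})
    (l r : nat) (x : R) : R :=
  (lt_cdf rho x ^+ l * Num.max (1 - x) 0 ^+ r)%R.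

Lemma pivot_weight_ge0 rho l r x : (0 <= pivot_weight rho l r x)%R.
Proof.
by rewrite mulr_ge0// exprn_ge0// ?lt_cdf_ge0// le_max lexx orbT.
Qed.

Lemma measurable_pivot_weight rho l r :
  measurable_fun setT (pivot_weight rho l r).
Proof.
apply: measurable_funM; apply: measurable_funX; first exact: measurable_lt_cdf.
by apply: measurable_maxr => //; exact: measurable_funB.
Qed.

(** Given a pivot with Z-value z, each index of [S] contributes P(Z < z, X in G) and each remaining
    one 1 - F(z). The product depends on the pivot only through F(z), so integrating over pivots
    with X in [G] becomes an integral against [rank_law]. *)
Lemma pivot_event_prob G (mG : measurable G) k (S : {set 'I_n}) : k \notin S ->
  Q (pivot_event G k S) =
  \int[rank_law mG]_x (pivot_weight (rank_law mG) #|S| (n - #|S|.+1) x)%:E.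
Proof.
move=> kS; rewrite pivot_eventE//.
rewrite (@pivot_integral _ _ _ _ _ Q _ W mW mu hiid.1 lawW k)//; last 2 first.
- by move=> a; exact: mD.
- exact: msnd.
pose f := pivot_weight (rank_law mG) #|S| (n - #|S|.+1).
have mf : measurable_fun setT (EFin \o f).
  by apply/measurable_EFinP; exact: measurable_pivot_weight.
transitivity (\int[mu]_(p in snd @^-1` G) (f (F p.1))%:E).
  apply: eq_integral => p _.
  rewrite (eq_bigr (fun a => (if a \in S then lt_cdf (rank_law mG) (F p.1)
      else Num.max (1 - F p.1) 0)%R%:E)); last first.
    move=> a ak; rewrite muE /D; case: ifPn => aS.
      rewrite -lt_cdf_rank_law; congr (P _).
      by apply/seteqP; split=> w; rewrite /xsection /= inE.
    rewrite max_l ?subr_ge0 ?marginal_cdf_le1// EFinB marginal_cdfE.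
    rewrite -probability_setC; last exact: measurable_RV_le.
    congr (P _); apply/seteqP; split=> w; rewrite /xsection /= inE/=.
      by rewrite ltNge => /negP.
    by move=> /negP; rewrite -ltNge.
  rewrite prodEFin; congr EFin; rewrite (bigID (mem S))/=; congr (_ * _)%R.
    rewrite (eq_bigr (fun=> lt_cdf (rank_law mG) (F p.1))); last first.
      by move=> a /andP[_ ->].
    rewrite prodr_const; congr (_ ^+ _)%R; apply: eq_card => a.
    rewrite unfold_in /=; case: (boolP (a \in S)) => aS; rewrite ?andbF// andbT.
    by apply: contraNneq kS => <-.
  rewrite (eq_bigr (fun=> Num.max (1 - F p.1) 0)%R); last first.
    by move=> a /andP[_ /negbTE ->].
  rewrite prodr_const; congr (_ ^+ _)%R.
  have <- : #|~: (k |: S)| = (n - #|S|.+1)%N.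
    by rewrite cardsCs finset.setCK card_ord cardsU1 kS.
  by apply: eq_card => a; rewrite unfold_in /= finset.in_setC finset.in_setU1
    negb_or.
have mfF : measurable_fun setT (fun p : R * R => (f (F p.1))%:E).
  apply: (measurableT_comp mf); apply: measurableT_comp => //.
  exact: measurable_marginal_cdf.
have f0 x : (0 <= f x)%R by exact: pivot_weight_ge0.
rewrite integral_mkcond ge0_integral_restricted_law//; first last.
- by move=> p; rewrite patchE; case: ifP => // _; rewrite lee_fin.
- apply/(measurable_restrictT _ _).1; first exact: msnd.
  exact: measurable_funTS.
rewrite ge0_integral_restricted_law//.
rewrite [RHS]integral_mkcond; apply: eq_integral => w _.
by rewrite !patchE; congr (if _ then _ else _); apply/idP/idP; rewrite !inE.
Qed.

End pivot_event.

(** * Counting the configurations and summing over them *)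

Lemma cards_pointed_draws n l :
  #|[set p : 'I_n * {set 'I_n} | (p.1 \notin p.2) && (#|p.2| == l)]%SET| =
  (n * 'C(n.-1, l))%N.
Proof.
transitivity (\sum_(k < n)
    \sum_(S : {set 'I_n} | (k \notin S) && (#|S| == l)) 1)%N.
  by rewrite pair_big_dep -sum1_card; apply: eq_bigl => p; rewrite inE.
rewrite (eq_bigr (fun=> 'C(n.-1, l))); last first.
  move=> k _; rewrite sum1_card.
  have -> : n.-1 = #|~: [set k]%SET|.
    by rewrite cardsCs finset.setCK card_ord cards1 subn1.
  rewrite -cards_draws; apply: eq_card => S.
  rewrite unfold_in /= inE; congr (_ && _).
  by rewrite -finset.disjoints_subset disjoint_sym disjoints1.
by rewrite sum_nat_const card_ord.
Qed.

Section success_event.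
Local Open Scope ereal_scope.
Context (R : realType) d' (T' : measurableType d') (Q : probability T' R).
Variables (n l : nat) (Zs Xs : 'I_n -> {RV Q >-> R}) (xstar : \bar R).
Hypothesis ln : (l < n)%N.
Hypothesis ties0 : forall i j, i != j -> Q [set w | Zs i w = Zs j w] = 0.

Let G := [set x : R | xstar < x%:E].

Hypothesis mev : forall (H : set R) k (S : {set 'I_n}), measurable H -> k \notin S ->
  measurable (pivot_event Zs Xs H k S).

Let mG : measurable G.
Proof.
have := @measurable_fun_lte _ _ _ setT (cst xstar) (@EFin R) _ _ measurableT
  [set true].
rewrite setTI => H; rewrite (_ : G = (fun x : R => xstar < x%:E) @^-1` [set true]).
  by apply: H.
by apply/seteqP; split.
Qed.

(** A finite union written as a countable one through [pickle], so that countable subadditivity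
    makes it null. *)
Let ties : set T' := \bigcup_k
  (if unpickle k is Some p then
     if (p : 'I_n * 'I_n).1 != p.2 then [set w | Zs p.1 w = Zs p.2 w] else set0
   else set0).

Let mtie i j : measurable [set w | Zs i w = Zs j w].
Proof.
rewrite (_ : [set w | _] =
    [set w | (Zs i w <= Zs j w)%R] `&` [set w | (Zs j w <= Zs i w)%R]).
  by apply: measurableI; exact: measurable_RV2_le.
apply/seteqP; split=> w /= [].
  by move=> ->; rewrite lexx.
by move=> ? ?; apply/eqP; rewrite eq_le; apply/andP.
Qed.

Let mties : measurable ties.
Proof.
apply: bigcupT_measurable => k; case: unpickle => // p.
by case: ifP.
Qed.

Let Qties : Q ties = 0.
Proof.
apply: measure_negligible => //; apply: negligible_bigcup => k.
case: unpickle => [p|]; last exact: negligible_set0.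
case: ifP => [p12|_]; last exact: negligible_set0.
by apply/negligibleP => //; exact: ties0.
Qed.

Let notinties w : ~ ties w -> injective (fun i => Zs i w).
Proof.
move=> nt i j Zij; apply/eqP; apply/negP => /negP ij; apply: nt.
by exists (pickle (i, j)) => //; rewrite pickleK /= ij.
Qed.

Let success : set T' :=
  \bigcup_(i in `I_l.+1) [set w | (concomitant Zs Xs i w)%:E <= xstar].

Let msuccess : measurable success.
Proof.
apply: fin_bigcup_measurable => // i /= il.
by apply: measurable_concomitant_le; rewrite (leq_trans il).
Qed.

Let PS : {set 'I_n * {set 'I_n}} :=
  [set p : 'I_n * {set 'I_n} | (p.1 \notin p.2) && (#|p.2| == l)]%SET.

Let ev (H : set R) (p : 'I_n * {set 'I_n}) := pivot_event Zs Xs H p.1 p.2.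

Let evS p : ev G p `<=` ev setT p.
Proof. by move=> w [? _]. Qed.

(** Off the ties some configuration with [l] indices below the pivot occurs, and on it success is
    the negation of [ev G], because the first [l.+1] concomitants are the X-values of that
    configuration. *)
Let successE : success `&` ~` ties =
  \bigcup_(p in [set` enum PS]) ((ev setT p `\` ev G p) `&` ~` ties).
Proof.
have key w (p : 'I_n * {set 'I_n}) : injective (fun i => Zs i w) -> below Zs w p.1 p.2 ->
    #|p.2| = l -> success w <-> ~ ev G p w.
  move=> inj bw pl; split.
    move=> [i /= il Hi] [_ GX].
    have [|j jL jE] := (@concomitant_below _ _ _ (fun i => Zs i : T' -> R)
      (fun i => Xs i : T' -> R) w _ _ (concomitant Zs Xs i w) inj bw).1.
      by exists i => //; rewrite pl.
    by have := GX j jL; rewrite /G /= jE ltNge Hi.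
  move=> nev; have [j jL Hj] : exists2 j, j \in p.1 |: p.2 & (Xs j w)%:E <= xstar.
    apply: contrapT => H; apply: nev; split => // i iL.
    by rewrite /G /= ltNge; apply/negP => Hi; apply: H; exists i.
  have [|i il iE] := (@concomitant_below _ _ _ (fun i => Zs i : T' -> R)
    (fun i => Xs i : T' -> R) w _ _ (Xs j w) inj bw).2.
    by exists j.
  by exists i; rewrite /= -?pl// iE.
apply/seteqP; split=> [w [sw nt]|w [p]].
  have inj := notinties nt.
  have [k [S [bw Sl]]] :=
    @below_exists _ _ _ (fun i => Zs i : T' -> R) w l inj ln.
  exists (k, S).
    by rewrite /= mem_enum inE /= Sl eqxx andbT; case: bw.
  split=> //; split; first by split.
  exact/(key w (k, S)).
rewrite /= mem_enum inE => /andP[_ /eqP pl] [[[bw _] nev] nt].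
by split=> //; apply/(key w p) => //; exact: notinties.
Qed.

(** Off the ties configurations are disjoint by [below_unique]; each contributes its probability [c]
    of occurring minus its probability [e] of occurring with a failed search. *)
Lemma success_prob (c e : R) :
  (forall k (S : {set 'I_n}), k \notin S -> #|S| = l ->
     Q (pivot_event Zs Xs setT k S) = c%:E) ->
  (forall k (S : {set 'I_n}), k \notin S -> #|S| = l ->
     Q (pivot_event Zs Xs G k S) = e%:E) ->
  Q success = ((n * 'C(n.-1, l))%:R * (c - e))%:E.
Proof.
move=> Hc He.
have inPS (p : 'I_n * {set 'I_n}) : [set` enum PS] p -> (p.1 \notin p.2) /\ #|p.2| = l.
  by rewrite /= mem_enum inE => /andP[? /eqP].
have mev' p : [set` enum PS] p -> measurable (ev setT p `\` ev G p).
  by move=> /inPS[p12 _]; apply: measurableD; exact: mev.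
have remove_ties A : measurable A -> Q (A `&` ~` ties) = Q A.
  move=> mA; rewrite [RHS](measureDI _ mA mties) -setDE.
  rewrite [X in _ = _ + X](_ : _ = 0) ?adde0//.
  apply: (subset_measure0 _ mties) => //; exact: measurableI.
rewrite -remove_ties// successE measure_fin_bigcup//; first last.
- move=> p Pp; apply: measurableI; [exact: mev'|exact: measurableC].
- apply/trivIsetP => p p' /inPS[_ pl] /inPS[_ pl'] pp'.
  apply/seteqP; split => // w [[[[bw _] _] nt] [[[bw' _] _] _]].
  have [p1 p2] := @below_unique _ _ _ (fun i => Zs i : T' -> R) w
    _ _ _ _ (notinties nt) bw bw' (etrans pl (esym pl')).
  by move: pp'; rewrite [p]surjective_pairing p1 p2 -surjective_pairing eqxx.
rewrite -fsbig_seq ?enum_uniq//.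
rewrite big_seq (eq_bigr (fun=> (c - e)%:E)); last first.
  move=> p Pp; rewrite /= [LHS]remove_ties; last exact: mev'.
  have [p12 pl] := inPS p Pp.
  rewrite measureD//; [|exact: mev|exact: mev|].
    rewrite setIidr; last exact: evS.
    by rewrite EFinB; congr (_ - _); [exact: Hc|exact: He].
  by rewrite [X in X < _](Hc _ _ p12 pl) ltry.
rewrite -big_seq sumEFin big_const_seq count_predT -cardE cards_pointed_draws.
by rewrite iter_addr addr0 mulr_natl.
Qed.

End success_event.

(** * The iterated integral of the formula *)

(** The power of 1 - z_m involves the outermost variable alone and becomes a coefficient of the
    inner integral, leaving pivot weights divided by [l!] outside. Finiteness of [c] and [e] gives
    the integrability needed to split the difference. *)
Lemma iterated_integral_success (R : realType)
    (nu rho : {finite_measure set (measurableTypeR R) -> \bar R})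
    (h : R -> R) (l r : nat) (c e : R) :
  (forall A : set R, measurable A ->
     nu A = lebesgue_measure (A `&` `]0%R, 1%R[%classic)) ->
  measurable_fun setT h ->
  (forall A : set R, measurable A ->
     rho A = \int[lebesgue_measure]_(x in A `&` `]0%R, 1%R[%classic) (h x)%:E)%E ->
  (\int[nu]_x (pivot_weight nu l r x)%:E = c%:E)%E ->
  (\int[rho]_x (pivot_weight rho l r x)%:E = e%:E)%E ->
  iterated_integral l.+1 1
    (fun z : seq R =>
      ((1 - \prod_(j < l.+1) h z`_j) * (1 - z`_l) ^+ r)%:E) =
  ((c - e) / l`!%:R)%:E.
Proof.
move=> nuE mh rhoE Ic Ie.
have nuE1 (A : set R) : measurable A ->
    (nu A = \int[lebesgue_measure]_(x in A `&` `]0%R, 1%R[%classic) 1%R%:E)%E.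
  move=> mA; rewrite nuE// integral_cst ?mul1e//; exact: measurableI.
have m1 : measurable_fun setT (fun _ : R => 1%R : R) by [].
have mw (k : {finite_measure set (measurableTypeR R) -> \bar R}) :
    measurable_fun setT (pivot_weight k l r : R -> R).
  exact: measurable_pivot_weight.
rewrite (integral_on_unit m1 nuE1 (mw nu))// in Ic; last first.
  by move=> x; exact: pivot_weight_ge0.
rewrite (integral_on_unit mh rhoE (mw rho))// in Ie; last first.
  by move=> x; exact: pivot_weight_ge0.
have [|i1 I1] := integral_density_on_unit m1 nuE1 (lexx 1) (mw nu)
  (@pivot_weight_ge0 _ nu l r).
  by rewrite Ic ltry.
have [|i2 I2] := integral_density_on_unit mh rhoE (lexx 1) (mw rho)
  (@pivot_weight_ge0 _ rho l r).
  by rewrite Ie ltry.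
transitivity (\int[lebesgue_measure]_(z in `]0%R, 1%R[)
    ((l`!%:R^-1)%:E * (1 * pivot_weight nu l r z)%:E
     - (l`!%:R^-1)%:E * (h z * pivot_weight rho l r z)%:E))%E.
  apply: eq_integral => z; rewrite mem_setE in_itv/= => /andP[z0 z1].
  have z01 : 0 <= z <= 1 by rewrite !ltW.
  (* This is the shape of [iterated_integral_prod] with a = (1 - z)^r and e = h(z) (1 - z)^r. *)
  transitivity (iterated_integral l z (fun s =>
      ((1 - z) ^+ r - (h z * (1 - z) ^+ r) * \prod_(j < l) h s`_j)%:E)).
    apply: iterated_integral_ext => s sl.
    rewrite big_ord_recr/= nth_rcons sl ltnn eqxx.
    rewrite (eq_bigr (fun j : 'I_l => h s`_j)); last first.
      by move=> j _; rewrite nth_rcons sl ltn_ord.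
    by congr EFin; ring.
  rewrite (iterated_integral_prod nuE mh rhoE)// -!EFinM -EFinB; congr EFin.
  rewrite /pivot_weight (lt_cdf_unit nuE)// max_l ?subr_ge0 ?(ltW z1)//.
  move: (l`!%:R^-1) => a; ring.
rewrite integralB//=; [|exact: integrableZl..].
rewrite !integralZl// I1 I2 Ic Ie -!EFinM -EFinB; congr EFin.
by rewrite -mulrBr mulrC.
Qed.

(** * The threshold event and the copula event *)

Section success_threshold.
Local Open Scope ereal_scope.
Context (R : realType) d (T : measurableType d) (P : probability T R).
Variables (X : {RV P >-> R}) (alpha : R) (xstar : \bar R).
Hypothesis X0 : forall x, P [set w | X w = x] = 0.
Hypothesis halpha : (0 < alpha <= 1)%R.
Hypothesis hxstar : P [set w | (X w)%:E <= xstar] = alpha%:E.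

Let B := [set w | (X w)%:E <= xstar].
Let A := [set w | (marginal_cdf X (X w) <= alpha)%R].

Lemma measurable_RV_lee : measurable B.
Proof.
have := @measurable_fun_lee _ _ _ setT (EFin \o X) (cst xstar) _ _ measurableT
  [set true].
rewrite setTI => H; rewrite (_ : B =
    (fun w => (X w)%:E <= xstar) @^-1` [set true]).
  by apply: H => //; apply/measurable_EFinP; exact: measurable_funP.
by apply/seteqP; split => w /=.
Qed.

Lemma measurable_cdf_transform_le : measurable A.
Proof.
rewrite (_ : A = setT `&`
    (fun w => marginal_cdf X (X w)) @^-1` `]-oo, alpha]%classic).
  by apply: measurable_cdf_transform => //; exact: measurable_itv.
by rewrite setTI; apply/seteqP; split=> w /=; rewrite in_itv.
Qed.

(** A real threshold has F(xstar) = alpha, and [F] is monotone; [+oo] forces alpha = 1, an upper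
    bound of [F]; at [-oo] the event [B] is empty. *)
Lemma success_threshold_sub : B `<=` A.
Proof.
move=> w; rewrite /B /A /=; case: xstar hxstar => [r| |] // Xr.
  rewrite lee_fin => Xwr; rewrite (le_trans (marginal_cdf_nd X Xwr))//.
  rewrite -lee_fin marginal_cdfE -Xr; exact: lexx.
move=> _; rewrite (_ : alpha = 1%R) ?marginal_cdf_le1//.
apply: EFin_inj; rewrite -Xr (_ : mkset _ = setT) ?probability_setT//.
by apply/seteqP; split=> v //= _; rewrite leey.
Qed.

(** One event contains the other and both have probability alpha: [B] by the choice of [xstar], [A]
    because F(X) is uniform and its level set at alpha is null. *)
Lemma success_threshold_null : P (A `\` B) = 0.
Proof.
have mA := measurable_cdf_transform_le; have mB := measurable_RV_lee.
rewrite measureD//; last by rewrite ltey_eq fin_num_measure.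
rewrite setIidr; last exact: success_threshold_sub.
apply/eqP; rewrite sube_eq ?fin_num_adde_defl ?fin_num_measure//.
rewrite add0e [X in _ == X]hxstar; apply/eqP.
pose L := [set w | (marginal_cdf X (X w) < alpha)%R].
pose N := (fun w => marginal_cdf X (X w)) @^-1` [set alpha].
have mV := measurable_cdf_transform X.
have mL : measurable L.
  rewrite (_ : L = setT `&`
      (fun w => marginal_cdf X (X w)) @^-1` `]-oo, alpha[%classic).
    by apply: mV => //; exact: measurable_itv.
  by rewrite setTI; apply/seteqP; split=> w /=; rewrite in_itv.
have mN : measurable N by rewrite -[N]setTI; exact: mV.
have PN : P N = 0.
  rewrite /N cdf_transform_law//.
  apply: (@subset_measure0 _ _ _ lebesgue_measure _ [set alpha]).
  - by apply: measurableI.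
  - by [].
  - exact: subIsetl.
  - exact: lebesgue_measure_set1.
rewrite -(cdf_transform_lt X0 halpha).
have -> : A = L `|` N.
  apply/seteqP; split=> w; rewrite /A /L /N /=.
    by rewrite le_eqVlt => /orP[/eqP|]; [right|left].
  by case=> [/ltW//|->].
exact: measureU0.
Qed.

End success_threshold.

Theorem theorem3p1 (R : realType)
    (d : measure_display) (T : measurableType d) (P : probability T R)
    (Z X : {RV P >-> R}) (hcont : continuous (joint_cdf Z X))
    (n m : nat) (hm : (1 <= m <= n)%N)
    (alpha : R) (halpha : 0 < alpha <= 1)
    (xstar : \bar R) (hxstar : P [set w | ((X w)%:E <= xstar)%E] = alpha%:E)
    (d' : measure_display) (T' : measurableType d') (Q : probability T' R)
    (Zs Xs : 'I_n -> {RV Q >-> R}) (hiid : iid_copies Z X Zs Xs)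
    (C : R -> R -> R) (hC : conditional_copula Z X C) :
  p_success Zs Xs m xstar =
  ((n`!%:R / (n - m)`!%:R)%:E *
   iterated_integral m 1
     (fun z : seq R =>
        ((1 - \prod_(j < m) (1 - C alpha z`_j)) *
         (1 - z`_m.-1) ^+ (n - m))%:E))%E.
Proof.
have Z0 := joint_cdf_atomless1 hcont; have X0 := joint_cdf_atomless2 hcont.
(* [l] is m - 1, the number of draws ranked before the pivot. *)
case: m hm => [//|l] /= ln.
pose G := [set x : R | (xstar < x%:E)%E].
have mG : measurable G.
  rewrite (_ : G = ~` [set x : R | (x%:E <= xstar)%E]).
    apply: measurableC; case: xstar {hxstar G} => [r| |].
    - rewrite (_ : mkset _ = `]-oo, r]%classic); first exact: measurable_itv.
      by apply/seteqP; split=> x; rewrite /= in_itv/= lee_fin.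
    - rewrite (_ : mkset _ = setT)//.
      by apply/seteqP; split=> x //= _; rewrite leey.
    - rewrite (_ : mkset _ = set0)//.
      by apply/seteqP; split.
  by apply/seteqP; split=> x /=; rewrite /G /= ltNge => /negP.
have mV := measurable_cdf_transform Z.
have mVS (S : set R) : measurable S ->
    measurable ((fun w => marginal_cdf Z (Z w)) @^-1` S).
  by move=> mS; rewrite -[X in measurable X]setTI; exact: mV.
pose nu := rank_law Z X (measurableT : measurable [set: R]).
pose rho := rank_law Z X mG.
have nuE (A : set R) : measurable A ->
    nu A = lebesgue_measure (A `&` `]0%R, 1%R[%classic).
  move=> mA; rewrite -(cdf_transform_law Z0 mA).
  by rewrite /nu /= /restricted_law preimage_setT setIT.
have mh : measurable_fun setT (fun x => 1 - C alpha x : R).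
  by apply: measurable_funB => //; case: (hC alpha).
pose A := [set w | marginal_cdf X (X w) <= alpha].
pose B := [set w | ((X w)%:E <= xstar)%E].
have mA : measurable A by exact: measurable_cdf_transform_le.
have mB : measurable B by exact: measurable_RV_lee.
(* The version [C alpha] gives the density on the complement of [A], while [G] is the complement of
   [B]; the two differ by the null set [success_threshold_null]. *)
have rhoE (S : set R) : measurable S -> (rho S =
    \int[lebesgue_measure]_(x in S `&` `]0%R, 1%R[%classic) (1 - C alpha x)%:E)%E.
  move=> mS; rewrite -(cond_prob_density mV mA _ (hC alpha) mS); last first.
    exact: cdf_transform_law.
  have N0 := success_threshold_null X0 halpha hxstar.
  have mN : measurable (A `\` B) by exact: measurableD.
  change (P ((fun w => marginal_cdf Z (Z w)) @^-1` S `&` X @^-1` G) =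
    P ((fun w => marginal_cdf Z (Z w)) @^-1` S `&` ~` A)).
  have XG : X @^-1` G = ~` B.
    by apply/seteqP; split=> w; rewrite /G /B /= ltNge => /negP.
  have BA : B `<=` A by exact: success_threshold_sub.
  have mSN := measurableI _ _ (mVS S mS) mN.
  have SN0 := subset_measure0 mSN mN (@subIsetr _ _ _) N0.
  rewrite XG -[RHS](measureU0 _ mSN SN0); last first.
    by apply: measurableI; [exact: mVS|exact: measurableC].
  congr (P _); apply/seteqP; split=> w.
    by move=> [Sw nB]; have [Aw|nA] := pselect (A w); [right|left].
  by case=> [[Sw nA]|[Sw [Aw nB]]]; split=> // /BA.
have mev (H : set R) k (S : {set 'I_n}) : measurable H -> k \notin S ->
    measurable (pivot_event Zs Xs H k S).
  by move=> mH kS; exact: measurable_pivot_event.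
have evE H (mH : measurable H) k (S : {set 'I_n}) : k \notin S -> #|S| = l ->
    Q (pivot_event Zs Xs H k S) = (\int[rank_law Z X mH]_x
      (pivot_weight (rank_law Z X mH) l (n - l.+1) x)%:E)%E.
  by move=> kS Sl; rewrite (pivot_event_prob Z0 hiid mH kS) Sl.
(* The integral is finite as the probability of any one configuration, and a configuration exists
   because l < n. *)
have fin H (mH : measurable H) : exists c : R, (\int[rank_law Z X mH]_x
      (pivot_weight (rank_law Z X mH) l (n - l.+1) x)%:E)%E = c%:E.
  have : (0 < #|[set p : 'I_n * {set 'I_n} |
      (p.1 \notin p.2) && (#|p.2| == l)]%SET|)%N.
    rewrite cards_pointed_draws muln_gt0 bin_gt0.
    by case: (n) ln => // n'; rewrite ltnS.
  case/card_gt0P => -[k S]; rewrite inE /= => /andP[kS /eqP Sl].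
  exists (fine (Q (pivot_event Zs Xs H k S))).
  by rewrite -(evE _ _ _ _ kS Sl) fineK// fin_num_measure//; exact: mev.
have [c Ic] := fin _ (measurableT : measurable [set: R]).
have [e Ie] := fin _ mG.
transitivity ((n`!%:R / (n - l.+1)`!%:R)%:E * ((c - e) / l`!%:R)%:E)%E;
  last by congr (_ * _)%E;
    exact/esym/(iterated_integral_success nuE mh rhoE Ic Ie).
rewrite /p_success (success_prob ln (ties_null Z0 hiid) mev (c := c) (e := e)).
- rewrite -EFinM; congr EFin.
  (* The factor 1 / l! left by the inner integrals turns n! / (n - l - 1)! into the number of
     configurations. *)
  have nE : (n`! = n * 'C(n.-1, l) * (l`! * (n - l.+1)`!))%N.
    case: (n) ln => // n' ln'.
    by rewrite factS /= -(bin_fact (ln' : (l <= n')%N)) subSS mulnA.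
  rewrite nE !natrM.
  have f0 a : a`!%:R != 0 :> R by rewrite pnatr_eq0 -lt0n fact_gt0.
  move: (f0 l) (f0 (n - l.+1)%N) => a0 b0; field.
  by rewrite a0 b0.
- by move=> k S kS Sl; rewrite evE.
- by move=> k S kS Sl; rewrite evE.
Qed.
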